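(* Let $k\in(-1,1)$ be a constant and let $\lambda\in C^1(\mathbb R;\mathbb R_{>0})$ satisfy $\lambda(s)\ge\lambda_0$ for all $s\in\mathbb R$, where $\lambda_0>0$ is a constant. Consider $$\rho_t(y,t)+\big(\lambda(W(t))\rho(y,t)\big)_y=0,\ (y,t)\in(0,1)\times\mathbb R_{>0};\qquad \rho(0,t)-k\rho(1,t)=d(t),\ t>0;\qquad \rho(y,0)=\rho_0(y),\ y\in(0,1),$$ with $W(t):=\int_0^1\rho(y,t)\,dy$ and smooth $d$ and $\rho_0$. For $T>0$ put $M:=\frac1{1-|k|}\sup_{t\in(0,T)}|d(t)|$. For $p\in(1,\infty)$ let $G(s):=\frac1{p+1}s^{p+1}$ for $s\ge0$, $G(s):=0$ for $s<0$; for $r>0$ let $V(\rho):=\int_0^1e^{-ry}G(\rho(y,t))\,dy$ and $\widehat V(\rho):=V(\rho-M)+V(-\rho-M)$. Then: (i) For every $p\in(1,\infty)$ and every $r$ with $0<r\le(p+1)\ln\frac1{|k|}$, $\widehat V$ is a generalized ISS-Lyapunov functional (GISS-LF) of the system, and thus the system is ISS in the $L^{p+1}$-norm. In particular, the system admits the estimate, for all $t>0$, $$\|\rho(\cdot,t)\|_{L^{p+1}(0,1)}\le2e^{\frac r{p+1}}\|\rho_0\|_{L^{p+1}(0,1)}e^{-\frac{r\lambda_0}{p+1}t}+2\sup_{s\in(0,t)}|d(s)|.$$ (ii) Furthermore, for every $q\in[2,\infty]$, the system is ISS in the $L^q$-norm and admits the estimate, for all $t>0$, $$\|\rho(\cd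ot,t)\|_{L^q(0,1)}\le\frac2{|k|}\|\rho_0\|_{L^q(0,1)}|k|^{\frac{\lambda_0t}2}+\frac2{1-|k|}\sup_{s\in(0,t)}|d(s)|.$$
   Context: Standing assumption: all functions are sufficiently smooth, so that the problem has a classical solution and the computations are meaningful; statements concern these solutions. The input $d$ is bounded. $M$ depends on $T$. $\mathcal K$: continuous strictly increasing functions $\mathbb R_{\ge0}\to\mathbb R_{\ge0}$ vanishing at $0$; $\mathcal K_\infty$: unbounded elements of $\mathcal K$; $\mathcal{KL}$: continuous $\beta:\mathbb R_{\ge0}^2\to\mathbb R_{\ge0}$ with $\beta(\cdot,t)\in\mathcal K$ for each $t\ge 0$ and $\beta(s,\cdot)$ strictly decreasing to $0$ for each $s>0$. ISS in the $L^q$-norm: there are $\beta\in\mathcal{KL}$ and $\gamma\in\mathcal K$ such that all solutions satisfy $\|\rho(\cdot,t)\|_{L^q(0,1)}\le\beta(\|\rho_0\|_{L^q(0,1)},t)+\gamma(\sup_{s\in(0,t)}|d(s)|)$ for all $t>0$. GISS-LF (over the arbitrary time interval $(0,T)$): with $X:=L^{p+1}(0,1)$, the functional $\widehat V(x)=V(x-z_{d,T})+V(-x-z_{d,T})$, where $V:X\to\mathbb R_{\ge0}$ is continuous and $z_{d,T}\in X$, is called a GISS-LF if there are $\psi_1,\psi_2\in\mathcal K_\infty$, $\mu,\chi\in\mathcal K$ and a constant $\kappa>0$, independent of $T$ and $d$, such that: (1) $0\le V(x)\le\psi_1(\|x\|_X)$ for all $x\in X$; (2) $\psi_2(\|x\|_X)\le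 V(x-z)+V(-x-z)+\mu(\|z\|_X)$ for all $x,z\in X$; (3) for every $T>0$ and every input $d$, $\|z_{d,T}\|_X\le\chi(\sup_{t\in(0,T)}|d(t)|)$ and along solutions $\frac{d}{dt}\widehat V(\rho(\cdot,t))\le-\kappa\widehat V(\rho(\cdot,t))$ for all $t\in(0,T)$. Here $z_{d,T}$ is the constant $M$.
   Formalization: In (i) the gain 2 sup|d| is false for |k|>1/2 (k=3/4, ρ=1, d=1/4), so it is 2/(1-|k|) sup|d| in general and 2 sup|d| for |k|≤1/2; at k=0, where 2/|k| is undefined, (ii) gives ISS and ‖ρ‖≤2 sup|d| for λ₀t>2, and ln(1/|k|) is +∞. *)

(* Defs.v *)
From HB Require Import structures.
From mathcomp Require Import all_boot all_order all_algebra.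
From mathcomp Require Import all_classical all_reals all_analysis.

Set Implicit Arguments.
Unset Strict Implicit.
Unset Printing Implicit Defensive.

Import Order.TTheory GRing.Theory Num.Theory.
Import numFieldNormedType.Exports.

Local Open Scope classical_set_scope.
Local Open Scope ring_scope.

(* Functions on (0,1), [0,+oo[, ... are total functions on R of which only the
   values on the relevant set matter. *)

(* C^oo; only used with D open. *)
Definition smooth_on (R : realType) (D : set R) (f : R -> R) : Prop :=
  forall (n : nat) (x : R), D x -> derivable (derive1n n f) x 1.

Definition class_K (R : realType) (a : R -> R) : Prop :=
  [/\ {within `[0, +oo[%classic, continuous a},
      a 0 = 0 &
      forall s s' : R, 0 <= s -> s < s' -> a s < a s'].

Definition class_Koo (R : realType) (a : R -> R) : Prop :=
  class_K a /\ forall A : R, exists2 s : R, 0 <= s & A <= a s.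

Definition class_KL (R : realType) (b : R -> R -> R) : Prop :=
  [/\ {within [set z : R * R | 0 <= z.1 /\ 0 <= z.2],
         continuous (fun z : R * R => b z.1 z.2)},
      forall t : R, 0 <= t -> class_K (b ^~ t),
      forall s : R, 0 < s ->
        forall t t' : R, 0 <= t -> t < t' -> b s t' < b s t &
      forall s : R, 0 < s -> b s t @[t --> +oo] --> (0 : R)].

Definition Lnorm01 (R : realType) (q : \bar R) (x : R -> R) : \bar R :=
  Lnorm (@lebesgue_measure R) q (EFin \o (x \_ `]0, 1[%classic)).

Definition L01 (R : realType) (q : \bar R) : set (R -> R) :=
  [set x | (x \_ `]0, 1[%classic) \in Lfun (@lebesgue_measure R) q].

Definition sup_input (R : realType) (d : R -> R) (T : R) : R :=
  sup [set `|d t| | t in `]0, T[%classic].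

Definition admissible_input (R : realType) (d : R -> R) : Prop :=
  smooth_on `]0, +oo[%classic d /\
  exists C : R, forall t : R, 0 < t -> `|d t| <= C.

Definition total_mass (R : realType) (rho : R -> R -> R) (t : R) : R :=
  \int[@lebesgue_measure R]_(y in `]0, 1[%classic) rho y t.

(* Classical solutions: rho is jointly continuous up to the boundary of
   [0,1] x [0,+oo[ and jointly (Frechet) differentiable in the interior.
   rho takes y first and t second. *)
Record classical_solution (R : realType) (k : R) (lambda d rho0 : R -> R)
    (rho : R -> R -> R) : Prop := ClassicalSolution {
  sol_continuous :
    {within [set z : R * R | (0 <= z.1 <= 1) /\ 0 <= z.2],
       continuous (fun z : R * R => rho z.1 z.2)} ;
  sol_differentiable : forall y t : R, 0 < y < 1 -> 0 < t ->
    differentiable (fun z : R * R => rho z.1 z.2) (y, t) ;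
  sol_pde : forall y t : R, 0 < y < 1 -> 0 < t ->
    derive1 (fun s => rho y s) t +
    derive1 (fun x => lambda (total_mass rho t) * rho x t) y = 0 ;
  sol_boundary : forall t : R, 0 < t -> rho 0 t - k * rho 1 t = d t ;
  sol_initial : forall y : R, 0 < y < 1 -> rho y 0 = rho0 y
}.

(* A system is given by its trajectories: sys d rho0 rho means that rho is a
   solution with the (admissible) input d and the (admissible) initial
   datum rho0. *)
Definition transport_system (R : realType) (k : R) (lambda : R -> R)
    (d rho0 : R -> R) (rho : R -> R -> R) : Prop :=
  [/\ admissible_input d, smooth_on `]0, 1[%classic rho0 &
      classical_solution k lambda d rho0 rho].

(* The left-hand side is compared in \bar R, so finiteness of the norm of the
   solution is part of the claim. *)
Definition ISS (R : realType)
    (sys : (R -> R) -> (R -> R) -> (R -> R -> R) -> Prop) (q : \bar R) : Prop :=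
  exists (beta : R -> R -> R) (gamma : R -> R),
    [/\ class_KL beta, class_K gamma &
        forall (d rho0 : R -> R) (rho : R -> R -> R), sys d rho0 rho ->
        forall t : R, 0 < t ->
          (Lnorm01 q (rho ^~ t) <=
           (beta (fine (Lnorm01 q rho0)) t + gamma (sup_input d t))%:E)%E].

Definition sym_functional (R : realType) (V : (R -> R) -> R)
    (z x : R -> R) : R :=
  V (fun y => x y - z y) + V (fun y => - x y - z y).

Definition continuous_on_L01 (R : realType) (m : \bar R)
    (V : (R -> R) -> R) : Prop :=
  forall x : R -> R, L01 m x -> forall e : R, 0 < e ->
    exists2 delta : R, 0 < delta &
      forall x' : R -> R, L01 m x' ->
        (Lnorm01 m (fun y => x' y - x y)%R < delta%:E)%E -> `|V x' - V x| < e.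

(* The functional x |-> V (x - z_{d,T}) + V (- x - z_{d,T}) on X = L^m(0,1) is
   a GISS-LF of the system sys; z maps (d, T) to z_{d,T}. *)
Definition GISS_LF (R : realType)
    (sys : (R -> R) -> (R -> R) -> (R -> R -> R) -> Prop) (m : \bar R)
    (V : (R -> R) -> R) (z : (R -> R) -> R -> R -> R) : Prop :=
  let X := L01 m in
  let normX (x : R -> R) := fine (Lnorm01 m x) in
  [/\ continuous_on_L01 m V,
      forall (d : R -> R) (T : R), admissible_input d -> 0 < T -> X (z d T) &
      exists (psi1 psi2 mu chi : R -> R) (kappa : R),
        [/\ [/\ class_Koo psi1, class_Koo psi2, class_K mu, class_K chi &
                0 < kappa],
            forall x : R -> R, X x -> 0 <= V x <= psi1 (normX x),
            forall x w : R -> R, X x -> X w ->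
              psi2 (normX x) <= sym_functional V w x + mu (normX w) &
            forall (T : R) (d : R -> R), 0 < T -> admissible_input d ->
              normX (z d T) <= chi (sup_input d T) /\
              forall (rho0 : R -> R) (rho : R -> R -> R), sys d rho0 rho ->
              let Vhat t := sym_functional V (z d T) (rho ^~ t) in
              forall t : R, 0 < t < T ->
                derivable Vhat t 1 /\ derive1 Vhat t <= - kappa * Vhat t]].

Definition Gfun (R : realType) (p s : R) : R :=
  if 0 <= s then (p + 1)^-1 * s `^ (p + 1) else 0.

Definition Vfun (R : realType) (p r : R) (x : R -> R) : R :=
  \int[@lebesgue_measure R]_(y in `]0, 1[%classic)
    (expR (- r * y) * Gfun p (x y)).

Definition M_const (R : realType) (k : R) (d : R -> R) (T : R) : R :=
  (1 - `|k|)^-1 * sup_input d T.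

(* Main.v *)
Require Import Defs.
From HB Require Import structures.
From mathcomp Require Import all_boot all_order all_algebra.
From mathcomp Require Import all_classical all_reals all_analysis.
From mathcomp Require Import measurable_realfun ess_sup_inf ring lra.

Set Implicit Arguments.
Unset Strict Implicit.
Unset Printing Implicit Defensive.

Import Order.TTheory GRing.Theory Num.Theory.
Import numFieldNormedType.Exports.

Local Open Scope classical_set_scope.
Local Open Scope ring_scope.

(** Along the characteristics [y' = lambda (W t)] the solution is constant. If
    [A] is the primitive of [t |-> lambda (W t)] vanishing at [0], this gives
    [rho y t = f (y - A t)] for a single continuous [f], whose values on the
    negative half-line are the boundary values [rho 0 tau]. Hence, for every
    continuous [h], the functional [int_0^1 e^(- r y) h (rho y t) dy] is, by the
    fundamental theorem of calculus, a differentiable function of [A t] with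
    derivative [- r int_0^1 e^(- r y) h (rho y t) dy + h (rho 0 t) -
    e^(- r) h (rho 1 t)], and no derivative of [rho] is needed. For
    [h s = G (s - M) + G (- s - M)], the boundary condition and
    [|d| <= (1 - |k|) M] give
    [h (rho 0 t) <= |k|^(p+1) h (rho 1 t) <= e^(- r) h (rho 1 t)], which is the
    dissipation inequality. The [L^(p+1)] estimate follows by integration in
    time, since [V] is [G] applied to the [L^(p+1)] norm of a weighted positive
    part. In [L^oo], one has [|f s| <= M + e^(c s) |rho0|_oo] whenever
    [|k| <= e^(- c)], by induction on the number of passages of the
    characteristic through the boundary. *)

Lemma continuous_comp_within (T U V : topologicalType) (D : set U)
    (g : T -> U) (f : U -> V) :
  continuous g -> (forall x, D (g x)) -> {within D, continuous f} ->
  continuous (f \o g).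
Proof.
move=> cg Dg /subspace_continuousP cf x.
apply: (@cvg_comp _ _ _ g f _ (within D (nbhs (g x)))); last exact: cf.
move=> S; rewrite /within/= => /cg; rewrite /nbhs/=.
apply: filterS => z; apply; exact: Dg.
Qed.

Lemma primitive_exists (R : realType) (phi : R -> R) (a : R) :
  continuous phi ->
  exists P : R -> R, forall x, a < x -> is_derive x 1 P (phi x).
Proof.
move=> cphi.
exists (fun x => \int[@lebesgue_measure R]_(t in `[a, x]) phi t) => x ax.
have [||//||d e] := @continuous_FTC1_closed R phi a x (x + 1).
- by rewrite ltrDl.
- apply: continuous_compact_integrable; first exact: segment_compact.
  exact: continuous_subspaceT.
- exact: cphi.
by apply: DeriveDef; [exact: d | rewrite -derive1E].
Qed.

Lemma continuous_pair (T U V : topologicalType) (f : T -> U) (g : T -> V)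
    (x : T) :
  {for x, continuous f} -> {for x, continuous g} ->
  {for x, continuous (fun y => (f y, g y))}.
Proof. by move=> cf cg; exact: (cvg_pair cf cg). Qed.

(* Retraction of the plane onto the closed domain of the solutions. *)
Definition clip (R : realType) (z : R * R) : R * R :=
  (Num.max 0 (Num.min z.1 1), Num.max 0 z.2).

Lemma clip_continuous (R : realType) : continuous (@clip R).
Proof.
have cmax : continuous (Num.max 0 : R -> R).
  move=> x; apply: (@continuous_max R R (cst 0) id);
    [exact: cvg_cst|exact: cvg_id].
have cmin : continuous (fun x : R => Num.min x 1).
  move=> x; apply: (@continuous_min R R id (cst 1));
    [exact: cvg_id|exact: cvg_cst].
move=> z; apply: (@continuous_pair (R * R)%type R R
  (fun z => Num.max 0 (Num.min z.1 1)) (fun z => Num.max 0 z.2)).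
  apply: (@continuous_comp _ _ _ (fun z : R * R => Num.min z.1 1) (Num.max 0)).
    apply: (@continuous_comp _ _ _ (@fst R R) (fun x : R => Num.min x 1)).
      exact: cvg_fst.
    exact: cmin.
  exact: cmax.
apply: (@continuous_comp _ _ _ (@snd R R) (Num.max 0)); last exact: cmax.
exact: cvg_snd.
Qed.

Lemma clip_in (R : realType) (z : R * R) :
  (0 <= (clip z).1 <= 1) /\ 0 <= (clip z).2.
Proof.
by rewrite /clip /= !le_max !lexx /= ge_max ge_min ler01 lexx orbT.
Qed.

Lemma clip_id (R : realType) (y t : R) : 0 <= y <= 1 -> 0 <= t ->
  clip (y, t) = (y, t).
Proof.
move=> /andP[y0 y1] t0; rewrite /clip /=.
by rewrite (min_idPl y1) !(max_idPr _).
Qed.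

Lemma integrable_continuous_itv01 (R : realType) (f : R -> R) :
  {within `[0, 1], continuous f} ->
  (@lebesgue_measure R).-integrable `]0, 1[ (EFin \o f).
Proof.
move=> cf; have icc : (@lebesgue_measure R).-integrable `[0, 1] (EFin \o f).
  by apply: continuous_compact_integrable => //; exact: segment_compact.
apply: integrableS icc => //; exact: subset_itv_oo_cc.
Qed.

Lemma Rintegral_param_continuous (R : realType) (F : R * R -> R) :
  continuous F ->
  continuous (fun t => \int[@lebesgue_measure R]_(y in `]0, 1[) F (y, t)).
Proof.
move=> cF t.
have cFy s : continuous (fun y => F (y, s)).
  move=> y; apply: (@continuous_comp _ _ _ (fun y => (y, s)) F); last exact: cF.
  by apply: (@continuous_pair _ _ _ id (cst s)); [exact: cvg_id|exact: cvg_cst].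
have cFt y : continuous (fun s => F (y, s)).
  move=> s; apply: (@continuous_comp _ _ _ (fun s => (y, s)) F); last exact: cF.
  by apply: (@continuous_pair _ _ _ (cst y) id); [exact: cvg_cst|exact: cvg_id].
have [B [_ hB]] : bounded_set (F @` (`[0, 1] `*` `[t - 1, t + 1])).
  apply: compact_bounded; apply: continuous_compact.
    exact: continuous_subspaceT.
  by apply: compact_setX; exact: segment_compact.
have hB1 : forall y s, 0 < y < 1 -> t - 1 < s < t + 1 -> `|F (y, s)| <= B + 1.
  move=> y s /andP[y0 y1] /andP[s0 s1]; apply: (hB (B + 1));
    first by rewrite ltrDl.
  by exists (y, s) => //; split; rewrite /= in_itv/= !ltW.
apply: (@continuity_under_integral R _ _ lebesgue_measure (fun t y => F (y, t))
  `]0, 1[ _ (t - 1) (t + 1) _ _ (fun=> B + 1)) => //.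
- move=> x _; apply: integrable_continuous_itv01.
  exact: continuous_subspaceT.
- by apply/nearW => y _ s _; exact: cFt.
- by apply: integrable_continuous_itv01 => x; exact: cvg_cst.
- by move=> s; rewrite /= in_itv/= => s01; apply/nearW => y;
  rewrite /= in_itv/= => y01; exact: hB1.
- by apply/mem_set; rewrite /= in_itv/= ltrBlDr !ltrDl !ltr01.
Qed.

Lemma is_derive_along_curve (R : realType) (g : R * R -> R) (f1 f2 : R -> R)
    (u a b : R) :
  differentiable g (f1 u, f2 u) -> is_derive u 1 f1 a -> is_derive u 1 f2 b ->
  is_derive u 1 (fun s => g (f1 s, f2 s)) ('d g (f1 u, f2 u) (a, b)).
Proof.
move=> dg [d1 e1] [d2 e2].
have D1 : differentiable f1 u by apply/derivable1_diffP.
have D2 : differentiable f2 u by apply/derivable1_diffP.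
have Dp : differentiable (fun s => (f1 s, f2 s)) u by exact:
  differentiable_pair.
have Dg : differentiable (g \o (fun s => (f1 s, f2 s))) u.
  exact: differentiable_comp.
apply: DeriveDef; first exact/derivable1_diffP.
rewrite (_ : (fun s => _) = g \o (fun s => (f1 s, f2 s)))// deriveE//.
rewrite diff_comp//= diff_pair//=.
by rewrite -!deriveE// e1 e2.
Qed.

(** * Characteristics *)

Lemma is_derive_continuous (R : realType) (f : R -> R) (x df : R) :
  is_derive x 1 f df -> {for x, continuous f}.
Proof. by case=> d _; apply: differentiable_continuous;
  apply/derivable1_diffP. Qed.

Lemma derive_lower_bound (R : realType) (A a : R -> R) (m : R) :
  (forall t : R, 0 <= t -> is_derive t 1 A (a t)) -> (forall t : R, m <= a t) ->
  forall s t : R, 0 <= s -> s <= t -> m * (t - s) <= A t - A s.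
Proof.
move=> dA am s t s0 st.
have [||c _ ->] := @MVT_segment R A a s t st.
- by move=> x; rewrite in_itv/= => /andP[sx _]; apply: dA; lra.
- apply: continuous_in_subspaceT => x; rewrite inE/= in_itv/= => /andP[sx _].
  by apply: is_derive_continuous (dA _ _); lra.
by apply: ler_wpM2r => //; rewrite subr_ge0.
Qed.

Lemma solution_clip_continuous (R : realType) (k : R) (lambda d rho0 : R -> R)
    (rho : R -> R -> R) :
  classical_solution k lambda d rho0 rho ->
  continuous (fun z : R * R => rho (clip z).1 (clip z).2).
Proof.
case=> cr _ _ _ _.
apply: (@continuous_comp_within _ _ _ [set z : R * R | 0 <= z.1 <= 1 /\ 0 <=
  z.2]
  (@clip R) (fun z => rho z.1 z.2)) => //.
- exact: clip_continuous.
- by move=> z; exact: clip_in.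
Qed.

Lemma solution_characteristics (R : realType) (k : R) (lambda d rho0 : R -> R)
    (rho : R -> R -> R) (A : R -> R) :
  classical_solution k lambda d rho0 rho -> (forall w : R, 0 < lambda w) ->
  (forall t : R, 0 <= t -> is_derive t 1 A (lambda (total_mass rho t))) ->
  forall x s y t : R, 0 <= s -> s <= t -> 0 <= x -> y <= 1 -> y - A t = x - A s
    ->
  rho y t = rho x s.
Proof.
move=> sol lam0 dA x s y t s0; rewrite le_eqVlt => /predU1P[<-|st] x0 y1 yx.
  by congr rho; lra.
have incA u v : 0 <= u -> u < v -> A u < A v.
  move=> u0 uv; rewrite -subr_gt0.
  have [||c] := @MVT R A (fun t => lambda (total_mass rho t)) u v uv.
  - by move=> z; rewrite in_itv/= => /andP[sx _]; apply: dA; lra.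
  - apply: continuous_in_subspaceT => z; rewrite inE/= in_itv/= => /andP[sx _].
    by apply: is_derive_continuous (dA _ _); lra.
  by move=> _ ->; rewrite mulr_gt0// subr_gt0.
pose f1 u := x + A u - A s.
have f1s : f1 s = x by rewrite /f1; lra.
have f1t : f1 t = y by rewrite /f1; lra.
pose phi u := rho (f1 u) u.
have f1in u : s <= u <= t -> 0 <= f1 u <= 1.
  move=> /andP[]; rewrite le_eqVlt => /predU1P[<- _|su].
    by rewrite f1s x0/=; have := incA _ _ s0 st; lra.
  rewrite le_eqVlt => /predU1P[->|ut]; rewrite /f1.
    have := incA _ _ s0 st; lra.
  have := incA _ _ s0 su; have := incA u t _ ut; lra.
have f1oo u : s < u < t -> 0 < f1 u < 1.
  move=> /andP[su ut]; rewrite /f1.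
  have := incA _ _ s0 su; have := incA u t _ ut; lra.
have dphi u : u \in `]s, t[ -> is_derive u 1 phi 0.
  rewrite in_itv/= => sut; have := f1oo _ sut => f101.
  have u0 : 0 < u by lra.
  set a := lambda (total_mass rho u).
  have dr := sol_differentiable sol f101 u0.
  have df1 : is_derive u 1 f1 a.
    have h := is_deriveD (is_derive_cst (x - A s) u 1) (dA u (ltW u0)).
    rewrite add0r in h.
    by rewrite (_ : f1 = cst (x - A s) + A)//; apply/funext => v;
      rewrite /f1 fctE/=; lra.
  apply: (@is_derive_eq _ _ _ phi _ _ _ _
    (is_derive_along_curve dr df1 (is_derive_id u 1))).
  set g := (fun z : R * R => rho z.1 z.2) in dr *.
  have dx : is_derive (f1 u) 1 (fun z => g (z, u)) ('d g (f1 u, u) (1, 0)).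
    exact: (@is_derive_along_curve _ g id (cst u) (f1 u) 1 0 dr).
  have dt : is_derive u 1 (fun z => g (f1 u, z)) ('d g (f1 u, u) (0, 1)).
    exact: (@is_derive_along_curve _ g (cst (f1 u)) id u 0 1 dr).
  have := sol_pde sol f101 u0.
  rewrite !derive1E (@derive_val _ _ _ _ _ _ _ dt).
  have dax := is_deriveZ a dx.
  rewrite (_ : (fun z => _) = a *: (fun z => g (z, u)))//.
  rewrite (@derive_val _ _ _ _ _ _ _ dax) => <-.
  rewrite (_ : (a, 1) = a *: (1, 0) + (0, 1)) ?linearD ?linearZ 1?addrC//.
  apply: injective_projections; rewrite /= /GRing.scale/= /GRing.scale/=; lra.
have cphi : {within `[s, t], continuous phi}; last first.
  have [c _] := @MVT_segment R phi (cst 0) s t (ltW st) dphi cphi.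
  by rewrite mul0r /phi f1s f1t => /eqP; rewrite subr_eq0 => /eqP.
have cF := solution_clip_continuous sol.
apply: (@subspace_eq_continuous _ _ _ (fun u => rho (clip (f1 u, u)).1 (clip
  (f1 u, u)).2)).
  move=> u; rewrite inE/= in_itv/= => sut.
  have u0 : 0 <= u by lra.
  exact: (congr1 (fun z => rho z.1 z.2) (clip_id (f1in u sut) u0)).
apply: continuous_in_subspaceT => u; rewrite inE/= in_itv/= => /andP[su _].
apply: (@continuous_comp _ _ _ (fun u => (f1 u, u))
  (fun z => rho (clip z).1 (clip z).2)); last exact: cF.
apply: (@continuous_pair _ _ _ f1 id); last exact: cvg_id.
apply: continuousB; last exact: cvg_cst.
apply: continuousD; first exact: cvg_cst.
by apply: is_derive_continuous (dA _ _); lra.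
Qed.

Lemma traveling_wave (R : realType) (k lambda0 : R) (lambda d rho0 : R -> R)
    (rho : R -> R -> R) :
  classical_solution k lambda d rho0 rho -> continuous lambda ->
  0 < lambda0 -> (forall w, lambda0 <= lambda w) ->
  exists A f : R -> R, [/\ A 0 = 0,
    forall t : R, 0 <= t -> is_derive t 1 A (lambda (total_mass rho t)),
    continuous f &
    forall y t, 0 <= y <= 1 -> 0 <= t -> rho y t = f (y - A t)].
Proof.
move=> sol clam lam0 lamge.
pose F (z : R * R) := rho (clip z).1 (clip z).2.
have cF : continuous F := solution_clip_continuous sol.
pose W t := \int[@lebesgue_measure R]_(y in `]0, 1[) F (y, t).
have WE t : 0 <= t -> W t = total_mass rho t.
  move=> t0; apply: eq_Rintegral => y; rewrite inE/= in_itv/= => y01.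
  by rewrite /F clip_id//=; lra.
have cW : continuous (lambda \o W).
  move=> t; apply: continuous_comp; last exact: clam.
  exact: Rintegral_param_continuous cF t.
have [A0 dA0] := primitive_exists (-1) cW.
pose A t := A0 t - A0 0.
have A00 : A 0 = 0 by rewrite /A subrr.
have dA : forall t : R, 0 <= t -> is_derive t 1 A (lambda (total_mass rho t)).
  move=> t t0; have t1 : -1 < t by lra.
  have h := is_deriveB (dA0 _ t1) (is_derive_cst (A0 0) t 1).
  by rewrite subr0 /= WE in h.
have Age : forall s t : R, 0 <= s -> s <= t -> lambda0 * (t - s) <= A t - A s.
  exact: derive_lower_bound dA _.
have BP : forall u, exists tau, 0 <= tau /\ A tau = Num.max 0 u.
  move=> u; set v := Num.max 0 u.
  have v0 : 0 <= v by rewrite le_max lexx.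
  have vl : 0 <= v / lambda0 by rewrite divr_ge0// ltW.
  have := Age _ _ (lexx 0) vl; rewrite subr0 A00 subr0 mulrC divfK ?gt_eqF// =>
    Av.
  have [||c] := @IVT R A 0 (v / lambda0) v vl.
  - apply: continuous_in_subspaceT => x; rewrite inE/= in_itv/= => /andP[sx _].
    exact: is_derive_continuous (dA _ _).
  - by rewrite A00 ge_min v0/= le_max Av orbT.
  by rewrite in_itv/= => /andP[c0 _] <-; exists c.
have [B hB] := choice BP.
have cB : continuous B.
  have Blip u v : lambda0 * `|B u - B v| <= `|u - v|.
    wlog uv : u v / B u <= B v.
      move=> h; have [/h//|/ltW/h] := leP (B u) (B v).
      by rewrite (distrC (B v)) (distrC v).
    rewrite distrC ger0_norm ?subr_ge0//.
    apply: (le_trans (Age _ _ (hB u).1 uv)).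
    rewrite (hB u).2 (hB v).2.
    by have [] := lerP 0 u; have [] := lerP 0 v; rewrite distrC;
      have := ler_norm (v - u);
      have := normr_ge0 (v - u); lra.
  move=> u; apply/cvgrPdist_lt => e e0; near=> v.
  rewrite -(ltr_pM2l lam0); apply: le_lt_trans (Blip u v) _.
  by near: v; apply: cvgr_dist_lt => //; rewrite mulr_gt0.
exists A, (fun s => F (s, B (- s))); split => //.
  move=> s; apply: (@continuous_comp _ _ _ (fun s => (s, B (- s))) F);
    last exact: cF.
  apply: (@continuous_pair _ _ _ id (fun s => B (- s))); first exact: cvg_id.
  apply: (@continuous_comp _ _ _ -%R B); last exact: cB.
  by apply: continuousN; exact: cvg_id.
move=> y t y01 t0; set s := y - A t.
have [tau0 tauA] := hB (- s); set tau := B (- s) in tau0 tauA *.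
have At0 : 0 <= A t.
  by have := Age _ _ (lexx 0) t0; rewrite A00 !subr0; apply: le_trans;
    rewrite mulr_ge0// ltW.
have lamP w : 0 < lambda w by exact: lt_le_trans lam0 (lamge w).
have tt : tau <= t.
  rewrite leNgt; apply/negP => ttau.
  have := Age _ _ t0 (ltW ttau); rewrite tauA.
  have : 0 < lambda0 * (tau - t) by rewrite mulr_gt0// subr_gt0.
  by have [] := lerP 0 (- s); rewrite /s; lra.
have s1 : s <= 1 by rewrite /s; lra.
rewrite /F /clip/= (max_idPr tau0) (min_idPl s1).
apply: (solution_characteristics sol lamP dA tau0 tt); rewrite ?tauA; try lra.
  by rewrite le_max lexx.
by have [] := lerP 0 (- s); have [] := lerP 0 s; rewrite /s; lra.
Unshelve. all: by end_near. Qed.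

Lemma continuous_mul (R : realType) (f g : R -> R) :
  continuous f -> continuous g -> continuous (fun x => f x * g x).
Proof. by move=> cf cg x; apply: cvgM; [exact: cf|exact: cg]. Qed.

Lemma continuous_expRM (R : realType) (r : R) :
  continuous (fun x => expR (r * x)).
Proof.
move=> x; apply: (@continuous_comp _ _ _ (fun x => r * x) expR);
  last exact: continuous_expR.
exact: mulrl_continuous.
Qed.

Lemma integral_weighted_shift (R : realType) (r a c : R) (g P : R -> R) :
  continuous g ->
  (forall x : R, a < x -> is_derive x 1 P (expR (- r * x) * g x)) -> a < - c ->
  \int[@lebesgue_measure R]_(y in `]0, 1[) (expR (- r * y) * g (y - c)) =
  expR (- r * c) * (P (1 - c) - P (- c)).
Proof.
move=> cg dP ac.
pose f y := expR (- r * y) * g (y - c).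
have cf : continuous f.
  apply: continuous_mul; first exact: continuous_expRM.
  move=> y; apply: (@continuous_comp _ _ _ (fun y => y - c) g); last exact: cg.
  by apply: continuousB; [exact: cvg_id|exact: cvg_cst].
pose Phi y := expR (- r * c) * P (y - c).
have dPhi (y : R) : 0 <= y -> is_derive y 1 Phi (f y).
  move=> y0; have acy : a < y - c by lra.
  have dyc : is_derive y 1 (fun y => y - c) 1.
    by rewrite -[X in is_derive _ _ _ X]subr0; exact: is_deriveB.
  have h := is_deriveZ (expR (- r * c)) (@is_derive1_comp _ P (fun y => y - c)
    y _ _ (dP _ acy) dyc).
  apply: (@is_derive_eq _ _ _ Phi _ _ _ _ h);
    rewrite mulr1 /GRing.scale/= /f mulrA -expRD.
  by congr (expR _ * _); ring.
have cPhi : {within `[0, 1], continuous Phi}.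
  apply: continuous_in_subspaceT => x; rewrite inE/= in_itv/= => /andP[x0 _].
  exact: is_derive_continuous (dPhi _ x0).
have int01 : (@lebesgue_measure R).-integrable `]0, 1[ (EFin \o f).
  by apply: integrable_continuous_itv01; exact: continuous_subspaceT.
have -> : \int[@lebesgue_measure R]_(y in `]0, 1[) f y =
          \int[@lebesgue_measure R]_(y in `[0, 1]) f y.
  have /integrableP[mf _] := int01.
  by rewrite /Rintegral [in RHS]integral_itv_bndoo; last exact: mf.
rewrite /Rintegral (@continuous_FTC2 R f Phi) //=.
- by rewrite /Phi sub0r; ring.
- exact: continuous_subspaceT.
- split.
  + by move=> x; rewrite in_itv/= => /andP[/ltW x0 _]; case: (dPhi _ x0).
  + apply: cvg_at_right_filter; exact: is_derive_continuous (dPhi _ (lexx 0)).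
  + apply: cvg_at_left_filter; exact: is_derive_continuous (dPhi _ ler01).
- move=> y; rewrite in_itv/= => /andP[y0 _].
  by rewrite derive1E (@derive_val _ _ _ _ _ _ _ (dPhi _ (ltW y0))).
Qed.

Lemma is_derive_weighted_shift (R : realType) (r c : R) (g : R -> R) :
  continuous g ->
  let V c := \int[@lebesgue_measure R]_(y in `]0, 1[)
    (expR (- r * y) * g (y - c)) in
  is_derive c 1 V (- r * V c + g (- c) - expR (- r) * g (1 - c)).
Proof.
move=> cg V.
have cgr : continuous (fun x => expR (- r * x) * g x).
  by apply: continuous_mul => //; exact: continuous_expRM.
have [P dP] := primitive_exists (- c - 1) cgr.
pose Q b := expR (- r * b) * (P (1 - b) - P (- b)).
have VQ b : - c - 1 < - b -> V b = Q b.
  by move=> bc; rewrite /V (@integral_weighted_shift R r (- c - 1) b g P).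
have c1 : - c - 1 < - c by lra.
apply: (@near_eq_is_derive _ _ _ Q).
  near=> b; rewrite VQ// -opprD ltrN2; near: b.
  by apply: lt_nbhsl; lra.
rewrite (VQ _ c1).
have d1 : is_derive c 1 (fun b => expR (- r * b)) (- r * expR (- r * c)).
  have h : is_derive c 1 (fun b => - r * b) (- r).
    by rewrite -[X in is_derive _ _ _ X]mulr1; exact: is_deriveZ.
  have h' := @is_derive1_comp _ expR (fun b => - r * b) c _ _ (is_derive_expR
    _) h.
  by apply: (@is_derive_eq _ _ _ (fun b => expR (- r * b)) _ _ _ _ h');
    rewrite mulrC.
have d2 : is_derive c 1 (fun b => P (1 - b)) (expR (- r * (1 - c)) * g (1 - c)
  * -1).
  have h : is_derive c 1 (fun b => 1 - b) (-1).
    by rewrite -[X in is_derive _ _ _ X]sub0r; exact: is_deriveB.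
  by apply: (@is_derive1_comp _ P (fun b => 1 - b) c _ _ _ h); apply: dP; lra.
have d3 : is_derive c 1 (fun b => P (- b)) (expR (- r * (- c)) * g (- c) * -1).
  by apply: (@is_derive1_comp _ P -%R c _ _ _ _); apply: dP; lra.
have h := is_deriveM d1 (is_deriveB d2 d3).
apply: (@is_derive_eq _ _ _ Q _ _ _ _ h); rewrite /GRing.scale/= /Q fctE.
rewrite (_ : - r * (1 - c) = - r + r * c); last by ring.
rewrite expRD mulrNN.
rewrite (_ : - r * c = - (r * c)); last by ring.
have := expRxMexpNx_1 (r * c).
set E := expR (r * c); set E' := expR (- (r * c)) => EE.
transitivity (- r * E' * (P (1 - c) - P (- c)) + (E * E') * (g (- c) - expR (-
  r) * g (1 - c))).
  by rewrite -[(- (fun b : R => _)) c]/(- P (- c)); ring.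
by rewrite EE; ring.
Unshelve. all: by end_near. Qed.

(** * The Lyapunov functional *)

Lemma GfunE (R : realType) (p s : R) : 0 < p + 1 ->
  Gfun p s = (p + 1)^-1 * Num.max 0 s `^ (p + 1).
Proof.
move=> p1; rewrite /Gfun; have [s0//|s0] := lerP 0 s.
by rewrite powR0 ?mulr0// gt_eqF.
Qed.

Lemma Gfun_ge0 (R : realType) (p s : R) : 0 < p + 1 -> 0 <= Gfun p s.
Proof. by move=> p1; rewrite GfunE// mulr_ge0 ?powR_ge0// invr_ge0 ltW. Qed.

Lemma ler_Gfun (R : realType) (p s s' : R) : 0 < p + 1 -> s <= s' ->
  Gfun p s <= Gfun p s'.
Proof.
move=> p1 ss'; rewrite !GfunE//; apply: ler_wpM2l;
  first by rewrite invr_ge0 ltW.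
apply: ge0_ler_powR; first exact: ltW.
- by rewrite nnegrE le_max lexx.
- by rewrite nnegrE le_max lexx.
- by rewrite ge_max !le_max lexx ss' orbT.
Qed.

Lemma GfunZ (R : realType) (p c s : R) : 0 < p + 1 -> 0 <= c ->
  Gfun p (c * s) = c `^ (p + 1) * Gfun p s.
Proof.
move=> p1 c0; rewrite !GfunE// mulrCA; congr (_ * _).
by rewrite -[X in Num.max X (c * s)](mulr0 c) -maxr_pMr// powRM//;
  rewrite le_max lexx.
Qed.

Lemma Gfun_continuous (R : realType) (p : R) : 0 < p + 1 ->
  continuous (Gfun p).
Proof.
move=> p1.
have -> : Gfun p = (fun s => (p + 1)^-1 * Num.max 0 s `^ (p + 1)).
  by apply/funext => s; rewrite GfunE.
move=> x; apply: cvgM; first exact: cvg_cst.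
have cmax : {for x, continuous (Num.max 0 : R -> R)}.
  by apply: (@continuous_max R R (cst 0) id); [exact: cvg_cst|exact: cvg_id].
have [x0|x0] := ltrP 0 x.
  apply: (@cvg_comp _ _ _ (Num.max 0) (fun a => a `^ (p + 1)) _
    (nbhs (Num.max 0 x))); first exact: cmax.
  rewrite (max_idPr (ltW x0)).
  have dx : derivable (fun a => a `^ (p + 1)) x 1.
    by apply: derivable_powR; rewrite in_itv/= x0.
  by move/derivable1_diffP/differentiable_continuous in dx.
rewrite powR0 ?gt_eqF//.
apply/cvgrPdist_lt => e e0; near=> y.
rewrite sub0r normrN ger0_norm ?powR_ge0//.
have -> : e = (e `^ (p + 1)^-1) `^ (p + 1).
  by rewrite -powRrM mulVf ?gt_eqF// powRr1// ltW.
apply: gt0_ltr_powR => //; rewrite ?nnegrE ?powR_ge0//.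
  by rewrite le_max lexx.
rewrite gt_max powR_gt0//=.
near: y; apply: lt_nbhsl.
by apply: le_lt_trans x0 _; rewrite powR_gt0.
Unshelve. all: by end_near. Qed.

Lemma boundary_dissipation (R : realType) (p k m u v : R) : 0 < p + 1 ->
  `|u - k * v| <= (1 - `|k|) * m ->
  Gfun p (u - m) + Gfun p (- u - m) <=
  `|k| `^ (p + 1) * (Gfun p (v - m) + Gfun p (- v - m)).
Proof.
move=> p1; rewrite ler_norml => /andP[h1 h2].
rewrite mulrDr -!GfunZ//.
have [k0|k0] := lerP 0 k.
  move: h1 h2; rewrite ger0_norm// => h1 h2.
  by apply: lerD; apply: ler_Gfun => //; lra.
move: h1 h2; rewrite ltr0_norm// => h1 h2.
by rewrite addrC; apply: lerD; apply: ler_Gfun => //; lra.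
Qed.

Lemma Vfun_ge0 (R : realType) (p r : R) (x : R -> R) : 0 < p + 1 ->
  0 <= Vfun p r x.
Proof.
move=> p1; apply: Rintegral_ge0 => y _.
by rewrite mulr_ge0 ?expR_ge0 ?Gfun_ge0.
Qed.

Lemma lyapunov_functional_derivative (R : realType) (p r m : R)
    (a A f : R -> R) (rho : R -> R -> R) :
  0 < p + 1 -> (forall t : R, 0 <= t -> is_derive t 1 A (a t)) ->
  continuous f ->
  (forall y t, 0 <= y <= 1 -> 0 <= t -> rho y t = f (y - A t)) ->
  let g s := Gfun p (s - m) + Gfun p (- s - m) in
  let V t := sym_functional (Vfun p r) (cst m) (rho ^~ t) in
  exists2 U : R -> R, forall t, 0 <= t -> V t = U t &
    forall t : R, 0 <= t ->
      is_derive t 1 U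
        ((- r * U t + g (rho 0 t) - expR (- r) * g (rho 1 t)) * a t).
Proof.
move=> p1 dA cf rhoE g V.
pose Q (h : R -> R) c := \int[@lebesgue_measure R]_(y in `]0, 1[)
  (expR (- r * y) * h (y - c)).
pose h1 s := Gfun p (f s - m); pose h2 s := Gfun p (- f s - m).
have ch1 : continuous h1.
  move=> s; apply: (@continuous_comp _ _ _ (fun s => f s - m) (Gfun p)).
    by apply: continuousB; [exact: cf|exact: cvg_cst].
  exact: Gfun_continuous.
have ch2 : continuous h2.
  move=> s; apply: (@continuous_comp _ _ _ (fun s => - f s - m) (Gfun p)).
    by apply: continuousB; [apply: continuousN; exact: cf|exact: cvg_cst].
  exact: Gfun_continuous.
exists (fun t => Q h1 (A t) + Q h2 (A t)) => t t0.
  have E1 : Vfun p r (fun y => rho y t - m) = Q h1 (A t).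
    apply: eq_Rintegral => y; rewrite inE/= in_itv/= => /andP[/ltW y0 /ltW y1].
    have y01 : 0 <= y <= 1 by rewrite y0.
    by rewrite /h1 (rhoE _ _ y01 t0).
  have E2 : Vfun p r (fun y => - rho y t - m) = Q h2 (A t).
    apply: eq_Rintegral => y; rewrite inE/= in_itv/= => /andP[/ltW y0 /ltW y1].
    have y01 : 0 <= y <= 1 by rewrite y0.
    by rewrite /h2 (rhoE _ _ y01 t0).
  by rewrite -E1 -E2.
have q1 : is_derive (A t) 1 (Q h1)
    (- r * Q h1 (A t) + h1 (- A t) - expR (- r) * h1 (1 - A t)).
  exact: is_derive_weighted_shift.
have q2 : is_derive (A t) 1 (Q h2)
    (- r * Q h2 (A t) + h2 (- A t) - expR (- r) * h2 (1 - A t)).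
  exact: is_derive_weighted_shift.
have d1 := @is_derive1_comp _ (Q h1) A t _ _ q1 (dA _ t0).
have d2 := @is_derive1_comp _ (Q h2) A t _ _ q2 (dA _ t0).
have d := is_deriveD d1 d2.
apply: (@is_derive_eq _ _ _ (fun t => Q h1 (A t) + Q h2 (A t)) _ _ _ _ d).
rewrite !rhoE ?lexx ?ler01// sub0r /g -/(h1 (- A t)) -/(h2 (- A t)).
rewrite -/(h1 (1 - A t)) -/(h2 (1 - A t)).
move: (Q h1 _) (Q h2 _) (h1 _) (h1 _) (h2 _) (h2 _) (expR _) (a t).
by move=> *; clear; ring.
Qed.

Lemma lyapunov_dissipation (R : realType) (k lambda0 p r m : R)
    (lambda d rho0 : R -> R) (rho : R -> R -> R) :
  classical_solution k lambda d rho0 rho -> continuous lambda ->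
  0 < lambda0 -> (forall w, lambda0 <= lambda w) ->
  0 < p + 1 -> 0 < r -> `|k| `^ (p + 1) <= expR (- r) ->
  let V t := sym_functional (Vfun p r) (cst m) (rho ^~ t) in
  exists U dU : R -> R, [/\ forall t, 0 <= t -> V t = U t,
    forall t : R, 0 <= t -> is_derive t 1 U (dU t) &
    forall t : R, 0 < t -> `|d t| <= (1 - `|k|) * m ->
      dU t <= - (r * lambda0) * U t].
Proof.
move=> sol clam lam0 lamge p1 r0 kr V.
have [A [f [_ dA cf rhoE]]] := traveling_wave sol clam lam0 lamge.
have [U VU dU] := @lyapunov_functional_derivative R p r m _ _ _ _ p1 dA cf rhoE.
eexists U, _; split; [exact: VU|exact: dU|] => t t0 dt.
have U0 : 0 <= U t by rewrite -(VU _ (ltW t0)); apply: addr_ge0;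
  exact: Vfun_ge0.
have := @boundary_dissipation R p k m (rho 0 t) (rho 1 t) p1.
rewrite (sol_boundary sol t0) => /(_ dt).
set g0 := Gfun p (rho 0 t - m) + Gfun p (- rho 0 t - m).
set g1 := Gfun p (rho 1 t - m) + Gfun p (- rho 1 t - m) => bd.
have g10 : 0 <= g1 by apply: addr_ge0; exact: Gfun_ge0.
have {}bd : g0 <= expR (- r) * g1 by apply: (le_trans bd); exact: ler_wpM2r.
set w := total_mass rho t.
apply: (@le_trans _ _ (- r * U t * lambda w)).
  apply: ler_wpM2r; first by rewrite (le_trans (ltW lam0))// lamge.
  by lra.
rewrite !mulNr lerN2 mulrAC; apply: ler_wpM2l => //.
by apply: mulr_ge0 => //; exact: ltW.
Qed.

Lemma lyapunov_decay (R : realType) (k lambda0 p r m T : R)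
    (lambda d rho0 : R -> R) (rho : R -> R -> R) :
  classical_solution k lambda d rho0 rho -> continuous lambda ->
  0 < lambda0 -> (forall w, lambda0 <= lambda w) ->
  0 < p + 1 -> 0 < r -> `|k| `^ (p + 1) <= expR (- r) -> 0 < T ->
  (forall t, 0 < t < T -> `|d t| <= (1 - `|k|) * m) ->
  sym_functional (Vfun p r) (cst m) (rho ^~ T) <=
    expR (- (r * lambda0 * T)) *
    sym_functional (Vfun p r) (cst m) (rho ^~ 0).
Proof.
move=> sol clam lam0 lamge p1 r0 kr T0 dT.
have [U [dU [VU dUE dUle]]] :=
  @lyapunov_dissipation R k lambda0 p r m _ _ _ _ sol clam lam0 lamge p1 r0 kr.
rewrite (VU _ (ltW T0)) (VU 0 (lexx 0)).
pose E t := expR (r * lambda0 * t).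
have dE (t : R) : is_derive t 1 E (r * lambda0 * E t).
  have h : is_derive t 1 (fun t => r * lambda0 * t) (r * lambda0).
    by rewrite -[X in is_derive _ _ _ X]mulr1; exact: is_deriveZ.
  have h' := @is_derive1_comp _ expR (fun t => r * lambda0 * t) t _ _
    (is_derive_expR _) h.
  by apply: (@is_derive_eq _ _ _ E _ _ _ _ h'); rewrite mulrC.
pose Z t := E t * U t.
have dZ (t : R) : 0 <= t -> is_derive t 1 Z (E t * (dU t + r * lambda0 * U t)).
  move=> t0; have h := is_deriveM (dE t) (dUE t t0).
  by apply: (@is_derive_eq _ _ _ Z _ _ _ _ h); rewrite /GRing.scale/=; ring.
have : Z T <= Z 0.
  apply: (@ler0_derive1_nincr R Z 0 T); rewrite ?lexx ?ltW//.
  - by move=> t; rewrite in_itv/= => /andP[/ltW t0 _]; case: (dZ _ t0).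
  - move=> t; rewrite in_itv/= => /andP[t0 tT].
    rewrite derive1E (@derive_val _ _ _ _ _ _ _ (dZ _ (ltW t0))).
    rewrite pmulr_rle0 ?expR_gt0//.
    by have := dUle _ t0 (dT t _); rewrite t0 tT => /(_ isT); lra.
  - apply: continuous_in_subspaceT => t; rewrite inE/= in_itv/= => /andP[t0 _].
    exact: is_derive_continuous (dZ _ t0).
rewrite /Z /E mulr0 expR0 mul1r => ZT.
by rewrite expRN mulrC ler_pdivlMr ?expR_gt0// mulrC.
Qed.

(** * Norms on the unit interval *)

Lemma L01P (R : realType) (q : \bar R) (x : R -> R) :
  L01 q x <->
  measurable_fun (`]0, 1[ : set R) x /\ (Lnorm01 q x < +oo)%E.
Proof.
have mD : measurable (`]0, 1[%classic : set R) by [].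
rewrite /L01 /=; split.
  by rewrite inE => /andP[/[!inE]/= /(measurable_restrictT _ mD) mx fx].
by move=> [/(measurable_restrictT _ mD) mx fx]; rewrite inE; apply/andP;
  rewrite !inE.
Qed.

Lemma Lnorm01_ge0 (R : realType) (q : \bar R) (x : R -> R) :
  (0 <= Lnorm01 q x)%E.
Proof. exact: Lnorm_ge0. Qed.

Lemma Lnorm01_fineK (R : realType) (q : \bar R) (x : R -> R) :
  L01 q x -> ((fine (Lnorm01 q x))%:E = Lnorm01 q x)%E.
Proof. by move=> /L01P[_ xf]; rewrite fineK// ge0_fin_numE// Lnorm01_ge0. Qed.

Lemma Lnorm01_eq (R : realType) (q : \bar R) (x y : R -> R) :
  (forall s, 0 < s < 1 -> x s = y s) -> Lnorm01 q x = Lnorm01 q y.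
Proof.
move=> xy; rewrite /Lnorm01 (_ : x \_ `]0, 1[ = y \_ `]0, 1[)//.
apply/funext => s; rewrite !patchE; case: ifPn => //.
by rewrite inE/= in_itv/= => /xy.
Qed.

Lemma Lnorm01_powR (R : realType) (q : R) (x : R -> R) : q != 0 ->
  (Lnorm01 q%:E x `^ q =
   \int[@lebesgue_measure R]_(y in `]0%R, 1%R[) (`|x y| `^ q)%:E)%E.
Proof.
move=> q0; rewrite /Lnorm01 (poweR_Lnorm _ _ q0) [RHS]integral_mkcond.
apply: eq_integral => y _; rewrite /= !patchE; case: ifPn => // _.
by rewrite normr0 powR0.
Qed.

Lemma measurable_norm_powR (R : realType) (q : R) (x : R -> R) :
  measurable_fun (`]0, 1[ : set R) x ->
  measurable_fun (`]0, 1[ : set R) (EFin \o (fun y => `|x y| `^ q)).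
Proof.
move=> mx; apply/measurable_EFinP.
apply: (measurableT_comp (measurable_powR q)).
exact: (measurableT_comp (@normr_measurable R setT) mx).
Qed.

Lemma le_Lnorm01 (R : realType) (q : \bar R) (x y : R -> R) : (1 <= q)%E ->
  measurable_fun (`]0, 1[ : set R) x -> measurable_fun (`]0, 1[ : set R) y ->
  (forall s, 0 < s < 1 -> `|x s| <= `|y s|) ->
  (Lnorm01 q x <= Lnorm01 q y)%E.
Proof.
case: q => [q| |]//; last first.
  move=> _ mx my xy; rewrite /Lnorm01 unlock; case: ifPn => // _.
  apply: le_ess_sup; apply/nearW => s /=; rewrite !patchE.
  by case: ifPn => //; rewrite inE/= in_itv/= lee_fin => /xy.
rewrite lee_fin => q1 mx my xy.
have q0 : 0 < q by exact: lt_le_trans q1.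
have qn0 : q != 0 by rewrite gt_eqF.
rewrite -[leLHS]poweRe1 ?Lnorm01_ge0// -[leRHS]poweRe1 ?Lnorm01_ge0//.
rewrite -(mulfV qn0) !poweRrM.
apply: gt0_ler_poweR; rewrite ?invr_ge0 ?(ltW q0)//.
- by rewrite in_itv/= poweR_ge0 leey.
- by rewrite in_itv/= poweR_ge0 leey.
rewrite !(Lnorm01_powR _ qn0); apply: ge0_le_integral => //.
- exact: measurable_norm_powR.
- exact: measurable_norm_powR.
move=> s; rewrite /= in_itv/= => s01; rewrite lee_fin.
by apply: ge0_ler_powR; rewrite ?nnegrE ?(ltW q0)//; exact: xy.
Qed.

Lemma Lnorm01D (R : realType) (q : \bar R) (x y : R -> R) : (1 <= q)%E ->
  measurable_fun (`]0, 1[ : set R) x -> measurable_fun (`]0, 1[ : set R) y ->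
  (Lnorm01 q (fun s => (x s + y s)%R) <= Lnorm01 q x + Lnorm01 q y)%E.
Proof.
move=> q1 mx my; rewrite /Lnorm01.
have -> : (fun s => x s + y s) \_ `]0, 1[ = ((x \_ `]0, 1[) \+ (y \_ `]0, 1[)).
  by apply/funext => s; rewrite /= !patchE; case: ifPn => //; rewrite addr0.
have mD : measurable (`]0, 1[%classic : set R) by [].
by apply: eminkowski => //; apply/(measurable_restrictT _ mD).
Qed.

Lemma Lnorm01_cst (R : realType) (q c : R) : 1 <= q ->
  Lnorm01 q%:E (cst c) = `|c|%:E.
Proof.
move=> q1; have q0 : 0 < q by exact: lt_le_trans q1.
have qn0 : q != 0 by rewrite gt_eqF.
rewrite -[LHS]poweRe1 ?Lnorm01_ge0//.
rewrite -(mulfV qn0) poweRrM (Lnorm01_powR _ qn0).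
rewrite (@integral_cst _ _ _ lebesgue_measure _ _ (`|c| `^ q)%:E)//.
have mu1 : lebesgue_measure (`]0, 1[%classic : set R) = 1%E.
  by rewrite lebesgue_measure_itv/= lte_fin ltr01 oppr0 adde0.
rewrite [X in (_ * X)%E](_ : _ = 1%E)// mule1.
by rewrite poweR_EFin -powRrM mulfV// powRr1.
Qed.

Lemma Lnorm01_le_bound (R : realType) (q : \bar R) (x : R -> R) (B : R) :
  (1 <= q)%E -> measurable_fun (`]0, 1[ : set R) x ->
  (forall s, 0 < s < 1 -> `|x s| <= B) -> (Lnorm01 q x <= B%:E)%E.
Proof.
move=> q1 mx xB.
have B0 : 0 <= B by apply: le_trans (xB 2^-1 _) => //; lra.
case: q q1 => [q q1| _|//].
  have := Lnorm01_cst B q1; rewrite (ger0_norm B0) => <-.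
  apply: le_Lnorm01 => //.
  by move=> s /xB; rewrite /= (ger0_norm B0).
rewrite /Lnorm01 unlock; case: ifPn => // _.
apply/ess_supP/nearW => s /=; rewrite patchE.
by case: ifPn => [|_]; rewrite ?inE/= ?in_itv/= lee_fin ?normr0//; exact: xB.
Qed.

Lemma Lnorm01Z (R : realType) (q c : R) (x : R -> R) : 1 <= q ->
  measurable_fun (`]0, 1[ : set R) x ->
  (Lnorm01 q%:E (fun s => (c * x s)%R) = `|c|%:E * Lnorm01 q%:E x)%E.
Proof.
move=> q1 mx.
have q0 : 0 < q by exact: lt_le_trans q1.
have qn0 : q != 0 by rewrite gt_eqF.
rewrite -[LHS]poweRe1 ?Lnorm01_ge0// -[in RHS](@poweRe1 _ (Lnorm01 _ _))
  ?Lnorm01_ge0//.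
rewrite -(mulfV qn0) !poweRrM !(Lnorm01_powR _ qn0).
under eq_integral do rewrite normrM powRM// EFinM.
rewrite ge0_integralZl_EFin ?powR_ge0//; last exact: measurable_norm_powR.
rewrite poweRM ?lee_fin ?powR_ge0//; last first.
  by apply: integral_ge0 => s _; rewrite lee_fin powR_ge0.
by rewrite poweR_EFin -powRrM mulfV// powRr1.
Qed.

Lemma le_L01 (R : realType) (q : \bar R) (x y : R -> R) : (1 <= q)%E ->
  measurable_fun (`]0, 1[ : set R) x -> L01 q y ->
  (forall s, 0 < s < 1 -> `|x s| <= `|y s|) ->
  L01 q x /\ fine (Lnorm01 q x) <= fine (Lnorm01 q y).
Proof.
move=> q1 mx Ly xy; have /L01P[my yf] := Ly.
have lexy := le_Lnorm01 q1 mx my xy.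
have Lx : L01 q x by apply/L01P; split => //; exact: le_lt_trans yf.
by split => //; rewrite -lee_fin !Lnorm01_fineK.
Qed.

Lemma L01D (R : realType) (q : \bar R) (x y : R -> R) : (1 <= q)%E ->
  L01 q x -> L01 q y ->
  L01 q (fun s => x s + y s) /\
  fine (Lnorm01 q (fun s => x s + y s)) <=
    fine (Lnorm01 q x) + fine (Lnorm01 q y).
Proof.
move=> q1 Lx Ly; have /L01P[mx xf] := Lx; have /L01P[my yf] := Ly.
have leD := Lnorm01D q1 mx my.
have Lxy : L01 q (fun s => x s + y s).
  apply/L01P; split; first exact: measurable_funD.
  by apply: le_lt_trans leD _; rewrite lte_add_pinfty.
by split => //; rewrite -lee_fin EFinD !Lnorm01_fineK.
Qed.

Lemma L01Z (R : realType) (q c : R) (x : R -> R) : 1 <= q -> L01 q%:E x ->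
  L01 q%:E (fun s => c * x s) /\
  fine (Lnorm01 q%:E (fun s => c * x s)) = `|c| * fine (Lnorm01 q%:E x).
Proof.
move=> q1 Lx; have /L01P[mx xf] := Lx.
have eqZ := Lnorm01Z c q1 mx.
have Lcx : L01 q%:E (fun s => c * x s).
  apply/L01P; split; first exact: measurable_funM.
  by rewrite eqZ -(Lnorm01_fineK Lx) -EFinM ltry.
by split => //; apply/EFin_inj; rewrite EFinM !Lnorm01_fineK.
Qed.

Lemma L01_cst (R : realType) (q c : R) : 1 <= q -> L01 q%:E (cst c).
Proof. by move=> q1; apply/L01P; split => //; rewrite Lnorm01_cst// ltry. Qed.

Lemma continuous_measurable01 (R : realType) (x : R -> R) :
  {within `[0, 1], continuous x} -> measurable_fun (`]0, 1[ : set R) x.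
Proof.
move=> /integrable_continuous_itv01/integrableP[+ _].
by move/measurable_EFinP.
Qed.

Lemma continuous_bounded01 (R : realType) (x : R -> R) :
  {within `[0, 1], continuous x} ->
  exists B, forall s, 0 <= s <= 1 -> `|x s| <= B.
Proof.
move=> cx.
have [B [_ hB]] : bounded_set (x @` `[0, 1]).
  by apply: compact_bounded; apply: continuous_compact => //;
    exact: segment_compact.
exists (B + 1) => s s01; apply: (hB (B + 1)); first by rewrite ltrDl.
by exists s.
Qed.

Lemma continuous_L01 (R : realType) (q : \bar R) (x : R -> R) : (1 <= q)%E ->
  {within `[0, 1], continuous x} -> L01 q x.
Proof.
move=> q1 cx; have [B xB] := continuous_bounded01 cx.
have mx := continuous_measurable01 cx.
apply/L01P; split => //.
apply: (@le_lt_trans _ _ B%:E); last exact: ltry.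
by apply: Lnorm01_le_bound => // s /andP[s0 s1]; apply: xB; rewrite !ltW.
Qed.

Definition weighted_pos (R : realType) (r q : R) (x : R -> R) (y : R) : R :=
  expR (- r / q * y) * Num.max 0 (x y).

Lemma weighted_pos_ge0 (R : realType) (r q : R) (x : R -> R) (y : R) :
  0 <= weighted_pos r q x y.
Proof. by rewrite mulr_ge0 ?expR_ge0// le_max lexx. Qed.

Lemma measurable_weighted_pos (R : realType) (r q : R) (x : R -> R) :
  measurable_fun (`]0, 1[ : set R) x ->
  measurable_fun (`]0, 1[ : set R) (weighted_pos r q x).
Proof.
move=> mx; apply: measurable_funM.
  apply: measurable_funS (continuous_measurable_fun (@continuous_expRM R (- r /
    q))) => //.
exact: measurable_maxr.
Qed.

Lemma Vfun_Lnorm01 (R : realType) (p r : R) (x : R -> R) : 0 < p + 1 ->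
  measurable_fun (`]0, 1[ : set R) x ->
  Vfun p r x =
  Gfun p (fine (Lnorm01 (p + 1)%:E (weighted_pos r (p + 1) x))).
Proof.
move=> p1 mx; set N := fine _.
have N0 : 0 <= N by apply: fine_ge0; exact: Lnorm01_ge0.
rewrite /Gfun N0 -fine_poweR Lnorm01_powR ?gt_eqF//.
have finZ (c : R) (y : \bar R) : 0 < c -> (0 <= y)%E -> fine (c%:E * y)%E = c *
  fine y.
  by move=> c0; case: y => [y| |]// _; rewrite gt0_muley ?lte_fin//= mulr0.
rewrite -finZ ?invr_gt0//; last by apply: integral_ge0 => y _;
  rewrite lee_fin powR_ge0.
rewrite /Vfun /Rintegral -ge0_integralZl_EFin ?invr_ge0 ?ltW//.
  congr fine; apply: eq_integral => y _; rewrite -EFinM; congr EFin.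
  rewrite GfunE// mulrCA ger0_norm ?weighted_pos_ge0//; congr (_ * _).
  rewrite powRM; last 2 first. by rewrite expR_ge0. by rewrite le_max lexx.
  congr (_ * _).
  by rewrite -expRM; congr expR; field; rewrite gt_eqF.
exact: (measurable_norm_powR (p + 1) (measurable_weighted_pos r (p + 1) mx)).
Qed.

Lemma weighted_pos_le (R : realType) (r q : R) (x : R -> R) (s : R) :
  0 <= r -> 0 < q -> 0 <= s ->
  weighted_pos r q x s <= Num.max 0 (x s).
Proof.
move=> r0 q0 s0; rewrite ler_piMl ?le_max ?lexx//.
by rewrite -[leRHS]expR0 ler_expR mulNr mulNr oppr_le0 mulr_ge0// divr_ge0//
  ltW.
Qed.

Lemma weighted_pos_ge (R : realType) (r q : R) (x : R -> R) (s : R) :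
  0 <= r -> 0 < q -> s <= 1 ->
  Num.max 0 (x s) <= expR (r / q) * weighted_pos r q x s.
Proof.
move=> r0 q0 s1; rewrite mulrA -expRD ler_peMl ?le_max ?lexx//.
rewrite -[leLHS]expR0 ler_expR mulNr mulNr subr_ge0.
by rewrite -[leRHS]mulr1 ler_wpM2l ?divr_ge0 ?(ltW q0).
Qed.

Lemma ler_max0_norm (R : realType) (a : R) : Num.max 0 a <= `|a|.
Proof. by rewrite ge_max normr_ge0 ler_norm. Qed.

Lemma weighted_pos_L01 (R : realType) (r q : R) (x : R -> R) : 1 <= q ->
  0 <= r -> L01 q%:E x ->
  L01 q%:E (weighted_pos r q x) /\
  fine (Lnorm01 q%:E (weighted_pos r q x)) <= fine (Lnorm01 q%:E x).
Proof.
move=> q1 r0 Lx; apply: le_L01 => //.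
  by apply: measurable_weighted_pos; case/L01P: Lx.
move=> s /andP[s0 _]; rewrite ger0_norm ?weighted_pos_ge0//.
apply: le_trans (ler_max0_norm _); apply: weighted_pos_le => //.
  exact: lt_le_trans q1.
exact: ltW.
Qed.

Lemma L01B (R : realType) (q : R) (x y : R -> R) : 1 <= q ->
  L01 q%:E x -> L01 q%:E y -> L01 q%:E (fun s => x s - y s).
Proof.
move=> q1 Lx Ly; have [LNy _] := L01Z (-1) q1 Ly.
have [] := L01D (q1 : (1 <= q%:E)%E) Lx LNy.
by rewrite (_ : (fun s => x s + -1 * y s) = (fun s => x s - y s))//;
  apply/funext => s; rewrite mulN1r.
Qed.

Lemma L01N (R : realType) (q : R) (x : R -> R) : 1 <= q ->
  L01 q%:E x -> L01 q%:E (fun s => - x s).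
Proof.
move=> q1 Lx; have [LNx _] := L01Z (-1) q1 Lx.
by rewrite (_ : (fun s => - x s) = (fun s => -1 * x s))//; apply/funext => s;
  rewrite mulN1r.
Qed.

Lemma Lnorm01_le_weighted_pos (R : realType) (r q : R) (x z : R -> R) :
  1 <= q -> 0 <= r -> L01 q%:E x -> L01 q%:E z ->
  fine (Lnorm01 q%:E x) <=
  expR (r / q) *
    (fine (Lnorm01 q%:E (weighted_pos r q (fun y => x y - z y))) +
     fine (Lnorm01 q%:E (weighted_pos r q (fun y => - x y - z y)))) +
  fine (Lnorm01 q%:E z).
Proof.
move=> q1 r0 Lx Lz.
set w1 := weighted_pos _ _ _; set w2 := weighted_pos _ _ _.
have [Lw1 _] := weighted_pos_L01 q1 r0 (L01B q1 Lx Lz).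
have [Lw2 _] := weighted_pos_L01 q1 r0 (L01B q1 (L01N q1 Lx) Lz).
have [Lw w_le] := L01D (q1 : (1 <= q%:E)%E) Lw1 Lw2.
have [Lcw cwE] := L01Z (expR (r / q)) q1 Lw.
have [Labs abs_le] : L01 q%:E (fun s => `|z s|) /\
    fine (Lnorm01 q%:E (fun s => `|z s|)) <= fine (Lnorm01 q%:E z).
  apply: le_L01 => //; last by move=> s _; rewrite normr_id.
  by case/L01P: Lz => mz _; exact: (measurableT_comp (@normr_measurable R setT)
    mz).
have [Lsum sum_le] := L01D (q1 : (1 <= q%:E)%E) Lcw Labs.
have mx : measurable_fun (`]0, 1[ : set R) x by case/L01P: Lx.
have q0 : 0 < q by exact: lt_le_trans q1.
have xle s : 0 < s < 1 ->
    `|x s| <= `|expR (r / q) * (w1 s + w2 s) + `|z s| |.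
  move=> /andP[s0 s1].
  have h1 := @weighted_pos_ge _ r q (fun y => x y - z y) s r0 q0 (ltW s1).
  have h2 := @weighted_pos_ge _ r q (fun y => - x y - z y) s r0 q0 (ltW s1).
  move: h1 h2; rewrite !ge_max => /andP[h1 h1'] /andP[h2 h2'].
  rewrite -/w1 in h1 h1'; rewrite -/w2 in h2 h2'.
  rewrite mulrDr [leRHS]ger0_norm; last by rewrite addr_ge0// addr_ge0.
  have zs := ler_norm (z s).
  by rewrite ler_norml; apply/andP; split; lra.
have [_ x_le] := le_L01 (q1 : (1 <= q%:E)%E) mx Lsum xle.
apply: le_trans x_le _; apply: le_trans sum_le _.
apply: lerD => //; rewrite cwE ger0_norm ?expR_ge0//.
by apply: ler_wpM2l => //; exact: expR_ge0.
Qed.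

Lemma weighted_pos_lipschitz (R : realType) (r q : R) (x x' : R -> R) :
  1 <= q -> 0 <= r -> L01 q%:E x -> L01 q%:E x' ->
  fine (Lnorm01 q%:E (weighted_pos r q x')) <=
  fine (Lnorm01 q%:E (weighted_pos r q x)) +
  fine (Lnorm01 q%:E (fun y => x' y - x y)).
Proof.
move=> q1 r0 Lx Lx'.
have q0 : 0 < q by exact: lt_le_trans q1.
have [Lw _] := weighted_pos_L01 q1 r0 Lx.
have [Lw' _] := weighted_pos_L01 q1 r0 Lx'.
have LB := L01B q1 Lx' Lx; have /L01P[mB _] := LB.
have [Labs abs_le] : L01 q%:E (fun s => `|x' s - x s|) /\
    fine (Lnorm01 q%:E (fun s => `|x' s - x s|)) <=
    fine (Lnorm01 q%:E (fun y => x' y - x y)).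
  apply: le_L01 => //; last by move=> s _; rewrite normr_id.
  exact: (measurableT_comp (@normr_measurable R setT) mB).
have [Lsum sum_le] := L01D (q1 : (1 <= q%:E)%E) Lw Labs.
have /L01P[mw' _] := Lw'.
have wle s : 0 < s < 1 -> `|weighted_pos r q x' s| <=
    `|weighted_pos r q x s + `|x' s - x s| |.
  move=> /andP[s0 s1]; rewrite [leRHS]ger0_norm ?addr_ge0 ?weighted_pos_ge0//.
  rewrite ger0_norm ?weighted_pos_ge0// -lerBlDl.
  rewrite /weighted_pos -mulrBr.
  have e1 : expR (- r / q * s) <= 1.
    rewrite -[leRHS]expR0 ler_expR mulNr mulNr oppr_le0 mulr_ge0 ?(ltW s0)//.
    by rewrite divr_ge0// ltW.
  have mB' : Num.max 0 (x' s) - Num.max 0 (x s) <= `|x' s - x s|.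
    have := ler_norm (x' s - x s); have := normr_ge0 (x' s - x s).
    by have [] := lerP 0 (x s); have [] := lerP 0 (x' s); lra.
  apply: (@le_trans _ _ (expR (- r / q * s) * `|x' s - x s|)).
    by apply: ler_wpM2l => //; exact: expR_ge0.
  exact: ler_piMl.
have [_ w_le] := le_L01 (q1 : (1 <= q%:E)%E) mw' Lsum wle.
apply: le_trans w_le _; apply: le_trans sum_le _.
exact: lerD.
Qed.

Lemma Vfun_continuous_on (R : realType) (p r : R) : 0 <= p -> 0 <= r ->
  continuous_on_L01 (p + 1)%:E (Vfun p r).
Proof.
move=> p0 r0 x Lx e e0.
have q1 : 1 <= p + 1 by lra.
have p1 : 0 < p + 1 by lra.
set N := fine (Lnorm01 (p + 1)%:E (weighted_pos r (p + 1) x)).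
have /cvgrPdist_lt/(_ e e0)/nbhs_ballP[delta /= delta0 hd] :=
  @Gfun_continuous R p p1 N.
exists delta => // x' Lx' xx'.
have LB := L01B q1 Lx' Lx.
have /L01P[mx _] := Lx; have /L01P[mx' _] := Lx'.
rewrite (Vfun_Lnorm01 r p1 mx) (Vfun_Lnorm01 r p1 mx').
rewrite distrC; apply: hd; rewrite /ball/=.
move: xx'; rewrite -(Lnorm01_fineK LB) lte_fin => xx'.
have l1 := weighted_pos_lipschitz q1 r0 Lx Lx'.
have l2 := weighted_pos_lipschitz q1 r0 Lx' Lx.
have e12 : fine (Lnorm01 (p + 1)%:E (fun y => x y - x' y)) =
           fine (Lnorm01 (p + 1)%:E (fun y => x' y - x y)).
  have [_] := L01Z (-1) q1 LB; rewrite normrN1 mul1r => <-.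
  by congr (fine (Lnorm01 _ _)); apply/funext => y; ring.
rewrite -/N in l1 l2 *; rewrite ltr_norml; lra.
Qed.

(** * Comparison functions and estimates *)

Lemma sup_input_ub (R : realType) (d : R -> R) (T t : R) :
  admissible_input d -> 0 < t < T -> `|d t| <= sup_input d T.
Proof.
move=> [_ [C dC]] /andP[t0 tT]; apply: ub_le_sup.
  by exists C => v [s /=]; rewrite in_itv/= => /andP[s0 _] <-; exact: dC.
by exists t => //=; rewrite in_itv/= t0.
Qed.

Lemma sup_input_ge0 (R : realType) (d : R -> R) (T : R) :
  admissible_input d -> 0 < T -> 0 <= sup_input d T.
Proof.
move=> ad T0; have T2 : 0 < T / 2 < T by lra.
exact: le_trans (normr_ge0 _) (sup_input_ub ad T2).
Qed.

Lemma class_Koo_powR (R : realType) (c q : R) : 0 < c -> 0 < q ->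
  class_Koo (fun s => c * s `^ q).
Proof.
move=> c0 q0; split; first split.
- have cG : continuous (fun s => c * q * Gfun (q - 1) s).
    by move=> s; apply: cvgM; [exact: cvg_cst|apply: Gfun_continuous;
      rewrite subrK].
  apply: (@subspace_eq_continuous _ _ _ (fun s => c * q * Gfun (q - 1) s)).
    move=> s; rewrite inE/= in_itv/= andbT => s0.
    by rewrite /from_subspace /Gfun s0 subrK -mulrA mulVKf// gt_eqF.
  exact: continuous_subspaceT.
- by rewrite powR0 ?mulr0// gt_eqF.
- move=> s s' s0 ss'; rewrite ltr_pM2l//; apply: gt0_ltr_powR => //.
  by rewrite nnegrE (le_trans s0)// ltW.
- move=> A; exists ((Num.max 0 A / c) `^ q^-1); first exact: powR_ge0.
  rewrite -powRrM mulVf ?gt_eqF// powRr1; last first.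
    by rewrite divr_ge0 ?le_max ?lexx// ltW.
  by rewrite mulrC divfK ?gt_eqF// le_max lexx orbT.
Qed.

Lemma class_K_scale (R : realType) (c : R) : 0 < c -> class_K (fun s => c * s).
Proof.
move=> c0; split; first by apply: continuous_subspaceT; exact: mulrl_continuous.
- by rewrite mulr0.
- by move=> s s' _ ss'; rewrite ltr_pM2l.
Qed.

Lemma class_KL_expR (R : realType) (c kappa : R) : 0 < c -> 0 < kappa ->
  class_KL (fun s t => c * s * expR (- (kappa * t))).
Proof.
move=> c0 kappa0; split.
- apply: continuous_subspaceT => z; apply: cvgM.
    by apply: cvgM; [exact: cvg_cst|exact: cvg_fst].
  apply: (@continuous_comp _ _ _ (@snd R R) (fun t => expR (- (kappa * t)))).
    exact: cvg_snd.
  have -> : (fun t => expR (- (kappa * t))) = (fun t => expR (- kappa * t)).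
    by apply/funext => t; rewrite mulNr.
  exact: continuous_expRM.
- move=> t _.
  have -> : (fun s => c * s * expR (- (kappa * t))) =
            (fun s => c * expR (- (kappa * t)) * s) by apply/funext => s; ring.
  by apply: class_K_scale; rewrite mulr_gt0 ?expR_gt0.
- move=> s s0 t t' _ tt'; rewrite ltr_pM2l ?mulr_gt0//.
  by rewrite ltr_expR ltrN2 ltr_pM2l.
- move=> s s0; rewrite -(mulr0 (c * s)); apply: cvgM; first exact: cvg_cst.
  apply: (@cvg_comp _ _ _ (fun t => kappa * t) (fun t => expR (- t)) _ +oo).
    apply/cvgryPge => B; near=> t.
    by rewrite mulrC -ler_pdivrMr//; near: t; exact: nbhs_pinfty_ge.
  exact: cvgr_expR.
Unshelve. all: by end_near. Qed.

Lemma powR_add3_le (R : realType) (a b c q : R) : 0 <= a -> 0 <= b -> 0 <= c ->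
  0 < q -> (a + b + c) `^ q <= 3 `^ q * (a `^ q + b `^ q + c `^ q).
Proof.
move=> a0 b0 c0 q0.
have h m : 0 <= m -> a <= m -> b <= m -> c <= m -> (a + b + c) `^ q <= 3 `^ q *
  m `^ q.
  move=> m0 am bm cm; rewrite -powRM//.
  apply: ge0_ler_powR; [exact: ltW|rewrite nnegrE; lra..|lra].
have := powR_ge0 a q; have := powR_ge0 b q; have := powR_ge0 c q.
move=> Ca Cb Cc.
have [ab|/ltW ba] := lerP a b; have [bc|/ltW cb] := lerP b c.
- apply: (le_trans (h c c0 (le_trans ab bc) bc (lexx _))).
  by apply: ler_wpM2l; rewrite ?powR_ge0//; lra.
- apply: (le_trans (h b b0 ab (lexx _) cb)).
  by apply: ler_wpM2l; rewrite ?powR_ge0//; lra.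
- have [ac|/ltW ca] := lerP a c.
    apply: (le_trans (h c c0 ac bc (lexx _))).
    by apply: ler_wpM2l; rewrite ?powR_ge0//; lra.
  apply: (le_trans (h a a0 (lexx _) ba ca)).
  by apply: ler_wpM2l; rewrite ?powR_ge0//; lra.
- apply: (le_trans (h a a0 (lexx _) ba (le_trans cb ba))).
  by apply: ler_wpM2l; rewrite ?powR_ge0//; lra.
Qed.

Lemma Gfun_reflect_le (R : realType) (p a b : R) : 0 < p + 1 -> 0 <= b ->
  Gfun p a <= Gfun p b -> a <= b.
Proof.
move=> p1 b0 Gab; rewrite leNgt; apply/negP => ba.
move: Gab; rewrite leNgt => /negP; apply.
have a0 : 0 <= a by exact: le_trans b0 (ltW ba).
rewrite /Gfun a0 b0 ltr_pM2l ?invr_gt0//.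
exact: gt0_ltr_powR.
Qed.

Lemma integrable_weighted_Gfun (R : realType) (p r : R) (x : R -> R) :
  0 < p + 1 -> {within `[0, 1], continuous x} ->
  (@lebesgue_measure R).-integrable `]0, 1[
    (EFin \o (fun y => expR (- r * y) * Gfun p (x y))).
Proof.
move=> p1 cx; apply: integrable_continuous_itv01.
have cE : {within `[0, 1], continuous (fun y : R => expR (- r * y))}.
  by apply: continuous_subspaceT; exact: continuous_expRM.
have cG : {within `[0, 1], continuous (Gfun p \o x)}.
  by apply: within_continuous_comp => // s _; exact: Gfun_continuous.
by move=> z; apply: cvgM; [exact: cE|exact: cG].
Qed.

Lemma within_continuous_shift (R : realType) (b c : R) (x : R -> R) :
  {within `[0, 1], continuous x} ->
  {within `[0, 1], continuous (fun y => b * x y + c)}.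
Proof.
move=> cx; apply: (@within_continuous_comp _ _ _ _ x (fun s => b * s + c)) =>
  //.
move=> s _; apply: continuousD; last exact: cvg_cst.
exact: mulrl_continuous.
Qed.

Lemma sym_functional_le (R : realType) (p r m : R) (x : R -> R) :
  0 <= p -> 0 <= r -> 0 <= m -> {within `[0, 1], continuous x} ->
  sym_functional (Vfun p r) (cst m) x <= Gfun p (fine (Lnorm01 (p + 1)%:E x)).
Proof.
move=> p0 r0 m0 cx.
have p1 : 0 < p + 1 by lra.
have q1 : (1 <= (p + 1)%:E)%E by rewrite lee_fin; lra.
have cabs : {within `[0, 1], continuous (fun y => `|x y|)}.
  apply: (@within_continuous_comp _ _ _ _ x (fun s => `|s|)) => // s _.
  exact: norm_continuous.
have c1 : {within `[0, 1], continuous (fun y => x y - m)}.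
  rewrite (_ : (fun y => _) = (fun y => 1 * x y + - m)).
    exact: within_continuous_shift.
  by apply/funext => y; rewrite mul1r.
have c2 : {within `[0, 1], continuous (fun y => - x y - m)}.
  rewrite (_ : (fun y => _) = (fun y => -1 * x y + - m)).
    exact: within_continuous_shift.
  by apply/funext => y; rewrite mulN1r.
have mabs := continuous_measurable01 cabs.
apply: (@le_trans _ _ (Vfun p 0 (fun y => `|x y|))).
  rewrite /sym_functional /Vfun -RintegralD//; last 2 first.
  - exact: integrable_weighted_Gfun.
  - exact: integrable_weighted_Gfun.
  apply: le_Rintegral => //.
  - have i1 := integrable_weighted_Gfun r p1 c1.
    have i2 := integrable_weighted_Gfun r p1 c2.
    exact: (integrableD _ i1 i2).
  - exact: integrable_weighted_Gfun.
  move=> y; rewrite /= in_itv/= => /andP[y0 y1].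
  rewrite -mulrDr oppr0 mul0r expR0 mul1r.
  apply: (@le_trans _ _ (1 * (Gfun p (x y - m) + Gfun p (- x y - m)))).
    apply: ler_wpM2r; first by apply: addr_ge0; exact: Gfun_ge0.
    by rewrite -expR0 ler_expR mulNr oppr_le0 mulr_ge0// ltW.
  rewrite mul1r.
  have n1 := ler_norm (x y); have n2 := ler_norm (- x y).
  rewrite normrN in n2.
  have [xy|xy] := lerP 0 (x y).
    have -> : Gfun p (- x y - m) = 0.
      by rewrite GfunE// (max_idPl _) ?powR0 ?mulr0 ?gt_eqF//; lra.
    by rewrite addr0; apply: ler_Gfun => //; lra.
  have -> : Gfun p (x y - m) = 0.
    by rewrite GfunE// (max_idPl _) ?powR0 ?mulr0 ?gt_eqF//; lra.
  by rewrite add0r; apply: ler_Gfun => //; lra.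
rewrite Vfun_Lnorm01//; apply: ler_Gfun => //.
set w := weighted_pos _ _ _.
have mw : measurable_fun (`]0, 1[ : set R) w by exact: measurable_weighted_pos.
have wx s : 0 < s < 1 -> `|w s| <= `|x s|.
  move=> _; rewrite /w /weighted_pos oppr0 !mul0r expR0 mul1r.
  by rewrite (max_idPr _)// normr_id.
by have [_] := le_L01 q1 mw (continuous_L01 q1 cx) wx.
Qed.

Lemma solution_continuous_slice (R : realType) (k : R) (lambda d rho0 : R -> R)
    (rho : R -> R -> R) (t : R) :
  classical_solution k lambda d rho0 rho -> 0 <= t ->
  {within `[0, 1], continuous (rho ^~ t)}.
Proof.
move=> sol t0; have cF := solution_clip_continuous sol.
apply: (@subspace_eq_continuous _ _ _
    (fun y => rho (clip (y, t)).1 (clip (y, t)).2)).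
  move=> y; rewrite inE/= in_itv/= => y01.
  exact: (congr1 (fun z => rho z.1 z.2) (clip_id y01 t0)).
apply: continuous_subspaceT => y.
apply: (@continuous_comp _ _ _ (fun y => (y, t))
  (fun z => rho (clip z).1 (clip z).2)); last exact: cF.
by apply: (@continuous_pair _ _ _ id (cst t)); [exact: cvg_id|exact: cvg_cst].
Qed.

Lemma Lnorm01_decay (R : realType) (k lambda0 p c m T : R)
    (lambda d rho0 : R -> R) (rho : R -> R -> R) :
  classical_solution k lambda d rho0 rho -> continuous lambda ->
  0 < lambda0 -> (forall w, lambda0 <= lambda w) ->
  0 <= p -> 0 < c -> `|k| <= expR (- c) -> 0 < T -> 0 <= m ->
  (forall t, 0 < t < T -> `|d t| <= (1 - `|k|) * m) ->
  fine (Lnorm01 (p + 1)%:E (rho ^~ T)) <=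
  2 * expR c * fine (Lnorm01 (p + 1)%:E rho0) * expR (- (c * lambda0 * T)) + m.
Proof.
move=> sol clam lam0 lamge p0 c0 kc T0 m0 dT.
have p1 : 0 < p + 1 by lra.
have q1 : 1 <= p + 1 by lra.
have q1e : (1 <= (p + 1)%:E)%E by rewrite lee_fin.
pose r := c * (p + 1).
have r0 : 0 < r by rewrite mulr_gt0.
have rq : r / (p + 1) = c by rewrite /r mulfK// gt_eqF.
have kr : `|k| `^ (p + 1) <= expR (- r).
  by rewrite /r -mulNr expRM; apply: ge0_ler_powR;
    rewrite ?nnegrE ?expR_ge0 ?(ltW p1).
have cT := solution_continuous_slice sol (ltW T0).
have cI := solution_continuous_slice sol (lexx 0).
have LT := continuous_L01 q1e cT.
have Lm := L01_cst m q1.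
have decay := lyapunov_decay sol clam lam0 lamge p1 r0 kr T0 dT.
have init := sym_functional_le p0 (ltW r0) m0 cI.
have eI : Lnorm01 (p + 1)%:E (rho ^~ 0) = Lnorm01 (p + 1)%:E rho0.
  by apply: Lnorm01_eq => s s01; exact: (sol_initial sol).
rewrite eI in init.
set n0 := fine (Lnorm01 (p + 1)%:E rho0) in init *.
have n00 : 0 <= n0 by apply: fine_ge0; exact: Lnorm01_ge0.
pose a := expR (- (c * lambda0 * T)) * n0.
have a0 : 0 <= a by rewrite mulr_ge0 ?expR_ge0.
have Va : sym_functional (Vfun p r) (cst m) (rho ^~ T) <= Gfun p a.
  apply: (le_trans decay); rewrite GfunZ ?expR_ge0// -expRM.
  rewrite (_ : - (c * lambda0 * T) * (p + 1) = - (r * lambda0 * T)); last first.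
    by rewrite /r; ring.
  by apply: ler_wpM2l => //; exact: expR_ge0.
have Nle x : measurable_fun (`]0, 1[ : set R) x ->
    Vfun p r x <= sym_functional (Vfun p r) (cst m) (rho ^~ T) ->
    fine (Lnorm01 (p + 1)%:E (weighted_pos r (p + 1) x)) <= a.
  move=> mx Vx; apply: (@Gfun_reflect_le _ p) => //.
  by rewrite -Vfun_Lnorm01//; exact: le_trans Vx Va.
have mB := L01B q1 LT Lm; have mB' := L01B q1 (L01N q1 LT) Lm.
have /L01P[{}mB _] := mB; have /L01P[{}mB' _] := mB'.
have N1 := Nle _ mB; have N2 := Nle _ mB'.
have {}N1 := N1 _; have {}N2 := N2 _.
have le1 := Lnorm01_le_weighted_pos q1 (ltW r0) LT Lm.
rewrite rq Lnorm01_cst//= (ger0_norm m0) in le1.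
apply: (le_trans le1); apply: lerD => //.
have -> : 2 * expR c * n0 * expR (- (c * lambda0 * T)) = expR c * (a + a).
  by rewrite /a; ring.
apply: ler_wpM2l; first exact: expR_ge0.
apply: lerD; [apply: N1|apply: N2]; rewrite /sym_functional.
  by rewrite lerDl Vfun_ge0.
by rewrite lerDr Vfun_ge0.
Qed.

Lemma traveling_wave_boundary (R : realType) (k T s : R)
    (lambda d rho0 a A f : R -> R) (rho : R -> R -> R) :
  classical_solution k lambda d rho0 rho -> 0 < T ->
  A 0 = 0 -> (forall t : R, 0 <= t -> is_derive t 1 A (a t)) ->
  (forall y t, 0 <= y <= 1 -> 0 <= t -> rho y t = f (y - A t)) ->
  - A T < s -> s < 0 ->
  exists2 tau, 0 < tau < T & f s = k * f (1 + s) + d tau.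
Proof.
move=> sol T0 A0 dA rhoE sT s0.
have cA : {within `[0, T], continuous A}.
  apply: continuous_in_subspaceT => x; rewrite inE/= in_itv/= => /andP[x0 _].
  exact: is_derive_continuous (dA _ x0).
have [|tau] := @IVT R A 0 T (- s) (ltW T0) cA.
  by rewrite A0 ge_min le_max; apply/andP; split; apply/orP; lra.
rewrite in_itv/= => /andP[]; rewrite le_eqVlt => /predU1P[<-|tau0].
  by rewrite A0; lra.
rewrite le_eqVlt => /predU1P[->|tauT] Atau; first by lra.
exists tau; first by rewrite tau0.
rewrite -(sol_boundary sol tau0) !rhoE ?lexx ?ler01 ?(ltW tau0)// Atau.
by rewrite !opprK add0r; ring.
Qed.

Lemma Linfty_pointwise_bound (R : realType) (x : R -> R) (B : R) :
  {within `[0, 1], continuous x} -> (Lnorm01 +oo x <= B%:E)%E ->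
  forall y, 0 <= y <= 1 -> `|x y| <= B.
Proof.
move=> cx xB y0 y01; rewrite leNgt; apply/negP => By.
have muT : (0 < lebesgue_measure [set: R])%E.
  have mu1 : lebesgue_measure (`]0, 1[ : set R) = 1%E.
    by rewrite lebesgue_measure_itv/= lte_fin ltr01 oppr0 adde0.
  apply: (@lt_le_trans _ _ (lebesgue_measure (`]0, 1[ : set R))).
    by rewrite mu1.
  by apply: le_measure; rewrite ?inE.
move: xB; rewrite /Lnorm01 unlock muT => /ess_supP [N [mN N0 subN]].
have /cvgrPdist_lt/(_ (`|x y0| - B))/= : x y @[y --> within `[0, 1] (nbhs y0)]
  --> x y0.
  by move/subspace_continuousP : cx; apply; rewrite /= in_itv/=.
rewrite subr_gt0 => /(_ By); rewrite /prop_near1 /within/= => -[e /= e0 he].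
pose u := Num.max 0 (y0 - e); pose v := Num.min 1 (y0 + e).
have uv : u < v.
  by rewrite /u /v gt_max !lt_min; apply/andP; split; apply/andP; lra.
have uvN : `]u, v[ `<=` N.
  move=> y; rewrite /= in_itv/= /u /v gt_max lt_min => /andP[/andP[yp yl]
    /andP[y1 yr]].
  apply: subN => /=; apply/negP; rewrite -ltNge lte_fin patchE mem_set/=;
    last first.
    by rewrite in_itv/= yp.
  have yin : y \in `[0, 1] by rewrite in_itv/= !ltW.
  have yb : ball_ [eta Num.norm] y0 e y by rewrite /ball_/= ltr_norml; lra.
  have := he y yb yin; have := ler_normB (x y0) (x y).
  have := ler_normD (x y0 - x y) (x y); rewrite subrK; lra.
have : (lebesgue_measure (`]u, v[ : set R) <= lebesgue_measure N)%E.
  by apply: le_measure; rewrite ?inE.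
rewrite N0 lebesgue_measure_itv/= lte_fin uv -EFinB lee_fin; lra.
Qed.

Lemma Linfty_decay (R : realType) (k lambda0 c m B T : R)
    (lambda d rho0 : R -> R) (rho : R -> R -> R) :
  classical_solution k lambda d rho0 rho -> continuous lambda ->
  0 < lambda0 -> (forall w, lambda0 <= lambda w) ->
  0 < c -> `|k| <= expR (- c) -> 0 < T -> 0 <= m ->
  (forall t, 0 < t < T -> `|d t| <= (1 - `|k|) * m) ->
  (forall y, 0 <= y <= 1 -> `|rho y 0| <= B) ->
  forall y, 0 < y <= 1 ->
  `|rho y T| <= expR c * B * expR (- (c * lambda0 * T)) + m.
Proof.
move=> sol clam lam0 lamge c0 kc T0 m0 dT rhoB y /andP[y0 y1].
have [A [f [A0 dA cf rhoE]]] := traveling_wave sol clam lam0 lamge.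
have B0 : 0 <= B by apply: le_trans (rhoB 0 _) => //; rewrite lexx ler01.
have fB n : forall s, - n%:R <= s -> - A T < s -> s <= 1 ->
    `|f s| <= m + expR (c * s) * B.
  elim: n => [|n IH] s ns sT s1.
    have s01 : 0 <= s <= 1 by rewrite s1 andbT; move: ns; rewrite oppr0.
    have := rhoB _ s01; rewrite rhoE// A0 subr0 => /le_trans; apply.
    rewrite -[leLHS]add0r lerD// ler_peMl// -[leLHS]expR0 ler_expR mulr_ge0
      ?(ltW c0)//.
    by case/andP: s01.
  have [s0|s0] := lerP 0 s; first by apply: IH => //;
    rewrite (le_trans _ s0)// oppr_le0.
  have [tau tauT ->] := traveling_wave_boundary sol T0 A0 dA rhoE sT s0.
  have IHs : `|f (1 + s)| <= m + expR (c * (1 + s)) * B.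
    by apply: IH; move: ns; rewrite -natr1; lra.
  apply: (le_trans (ler_normD _ _)); rewrite normrM.
  have h1 : `|k| * `|f (1 + s)| <= `|k| * m + `|k| * (expR (c * (1 + s)) * B).
    by rewrite -mulrDr ler_wpM2l.
  have h2 : `|k| * (expR (c * (1 + s)) * B) <= expR (c * s) * B.
    rewrite mulrA; apply: ler_wpM2r => //.
    rewrite (_ : c * s = - c + c * (1 + s)); last by ring.
    by rewrite expRD ler_wpM2r ?expR_ge0.
  have := dT _ tauT; lra.
have AT : lambda0 * T <= A T.
  by have := derive_lower_bound dA (fun t => lamge _) (lexx 0) (ltW T0);
    rewrite A0 !subr0.
have AT0 : 0 <= A T by apply: le_trans AT; rewrite mulr_ge0// ltW.
have nP := ltW (archi_boundP AT0); set n := Num.bound (A T) in nP.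
rewrite rhoE ?(ltW T0) ?(ltW y0)// [leRHS]addrC.
apply: (le_trans (fB n _ _ _ _)); try lra.
rewrite lerD2l mulrAC -expRD; apply: ler_wpM2r => //; rewrite ler_expR.
have h1 : 0 <= c * (1 - y) by rewrite mulr_ge0 ?subr_ge0// ltW.
have h2 : 0 <= c * (A T - lambda0 * T) by rewrite mulr_ge0 ?subr_ge0// ltW.
lra.
Qed.

Lemma initial_Lnorm01 (R : realType) (k : R) (lambda d rho0 : R -> R)
    (rho : R -> R -> R) (q : \bar R) :
  classical_solution k lambda d rho0 rho -> (1 <= q)%E ->
  Lnorm01 q rho0 = (fine (Lnorm01 q rho0))%:E.
Proof.
move=> sol q1.
have <- : Lnorm01 q (rho ^~ 0) = Lnorm01 q rho0.
  by apply: Lnorm01_eq => s s01; exact: (sol_initial sol).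
by rewrite Lnorm01_fineK//; apply: continuous_L01 => //;
  exact: (solution_continuous_slice sol).
Qed.

Lemma transport_estimate (R : realType) (k lambda0 c T : R)
    (lambda d rho0 : R -> R) (rho : R -> R -> R) (q : \bar R) :
  transport_system k lambda d rho0 rho -> `|k| < 1 -> continuous lambda ->
  0 < lambda0 -> (forall w, lambda0 <= lambda w) -> (1 <= q)%E ->
  0 < c -> `|k| <= expR (- c) -> 0 < T ->
  (Lnorm01 q (rho ^~ T) <=
   (2 * expR c * fine (Lnorm01 q rho0) * expR (- (c * lambda0 * T)) +
    M_const k d T)%:E)%E.
Proof.
move=> [ad _ sol] k1 clam lam0 lamge q1 c0 kc T0.
have sup0 := sup_input_ge0 ad T0.
have m0 : 0 <= M_const k d T by rewrite mulr_ge0// invr_ge0; lra.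
have dm t : 0 < t < T -> `|d t| <= (1 - `|k|) * M_const k d T.
  move=> tT; rewrite mulrA mulfV ?mul1r; first exact: sup_input_ub.
  by rewrite gt_eqF//; lra.
have cT := solution_continuous_slice sol (ltW T0).
case: q q1 => [q| |//] q1.
  rewrite -(Lnorm01_fineK (continuous_L01 q1 cT)) lee_fin.
  rewrite lee_fin in q1; have p0 : 0 <= q - 1 by lra.
  have := Lnorm01_decay sol clam lam0 lamge p0 c0 kc T0 m0 dm.
  by rewrite subrK.
have rho0E : Lnorm01 +oo (rho ^~ 0) = Lnorm01 +oo rho0.
  by apply: Lnorm01_eq => s s01; exact: (sol_initial sol).
set B := fine (Lnorm01 +oo rho0).
have B0 : 0 <= B by apply: fine_ge0; exact: Lnorm01_ge0.
have rhoB : forall y, 0 <= y <= 1 -> `|rho y 0| <= B.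
  apply: Linfty_pointwise_bound; first exact: (solution_continuous_slice sol).
  by rewrite rho0E (initial_Lnorm01 sol).
apply: Lnorm01_le_bound => //; first exact: continuous_measurable01.
move=> y /andP[y0 y1].
have y01 : 0 < y <= 1 by rewrite y0 ltW.
apply: le_trans (Linfty_decay sol clam lam0 lamge c0 kc T0 m0 dm rhoB y01) _.
rewrite lerD2r; apply: ler_wpM2r; first exact: expR_ge0.
by rewrite ler_wpM2r// ler_peMl ?expR_ge0// ler1n.
Qed.

Lemma transport_ISS (R : realType) (k lambda0 c : R) (lambda : R -> R)
    (q : \bar R) :
  `|k| < 1 -> continuous lambda ->
  0 < lambda0 -> (forall w, lambda0 <= lambda w) -> (1 <= q)%E ->
  0 < c -> `|k| <= expR (- c) ->
  ISS (transport_system k lambda) q.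
Proof.
move=> k1 clam lam0 lamge q1 c0 kc.
exists (fun s t => 2 * expR c * s * expR (- (c * lambda0 * t))),
  (fun s => (1 - `|k|)^-1 * s); split.
- by apply: class_KL_expR; rewrite mulr_gt0// expR_gt0.
- by apply: class_K_scale; rewrite invr_gt0 subr_gt0.
- by move=> d rho0 rho sys t t0; exact: (transport_estimate sys k1 clam lam0
  lamge q1 c0 kc t0).
Qed.

Lemma transport_open_loop_bound (R : realType) (lambda0 T : R)
    (lambda d rho0 : R -> R) (rho : R -> R -> R) (q : \bar R) :
  transport_system 0 lambda d rho0 rho -> continuous lambda ->
  0 < lambda0 -> (forall w, lambda0 <= lambda w) -> (1 <= q)%E ->
  1 < lambda0 * T ->
  (Lnorm01 q (rho ^~ T) <= (sup_input d T)%:E)%E.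
Proof.
move=> [ad _ sol] clam lam0 lamge q1 lamT.
have T0 : 0 < T by rewrite -(pmulr_rgt0 _ lam0); lra.
have [A [f [A0 dA cf rhoE]]] := traveling_wave sol clam lam0 lamge.
have AT : lambda0 * T <= A T.
  by have := derive_lower_bound dA (fun t => lamge _) (lexx 0) (ltW T0);
    rewrite A0 !subr0.
have cT := solution_continuous_slice sol (ltW T0).
apply: Lnorm01_le_bound => //; first exact: continuous_measurable01.
move=> y /andP[y0 y1].
rewrite rhoE ?(ltW y0) ?(ltW y1) ?(ltW T0)//.
have [||tau tauT ->] := traveling_wave_boundary (s := y - A T) sol T0 A0 dA
  rhoE; try lra.
by rewrite mul0r add0r; exact: sup_input_ub.
Qed.

Lemma transport_GISS (R : realType) (k lambda0 p r : R) (lambda : R -> R) :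
  `|k| < 1 -> continuous lambda ->
  0 < lambda0 -> (forall w, lambda0 <= lambda w) ->
  0 <= p -> 0 < r -> `|k| `^ (p + 1) <= expR (- r) ->
  GISS_LF (transport_system k lambda) (p + 1)%:E (Vfun p r)
    (fun d T => cst (M_const k d T)).
Proof.
move=> k1 clam lam0 lamge p0 r0 kr.
have p1 : 0 < p + 1 by lra.
have q1 : 1 <= p + 1 by lra.
have er0 := expR_gt0 r.
split; first by apply: Vfun_continuous_on => //; exact: ltW.
  by move=> d T _ _; exact: L01_cst.
exists (fun s => (p + 1)^-1 * s `^ (p + 1)),
  (fun s => (3 `^ (p + 1) * (expR r * (p + 1)))^-1 * s `^ (p + 1)),
  (fun s => (expR r * (p + 1))^-1 * s `^ (p + 1)),
  (fun s => (1 - `|k|)^-1 * s), (r * lambda0); split.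
- split; last exact: mulr_gt0.
  + by apply: class_Koo_powR; rewrite ?invr_gt0.
  + by apply: class_Koo_powR; rewrite ?invr_gt0 ?mulr_gt0 ?powR_gt0.
  + by case: (@class_Koo_powR R (expR r * (p + 1))^-1 (p + 1));
    rewrite ?invr_gt0 ?mulr_gt0.
  + by apply: class_K_scale; rewrite invr_gt0 subr_gt0.
- move=> x Lx; rewrite Vfun_ge0//=.
  have /L01P[mx _] := Lx.
  have [_ le_x] := weighted_pos_L01 q1 (ltW r0) Lx.
  rewrite Vfun_Lnorm01//; apply: le_trans (ler_Gfun p1 le_x) _.
  by rewrite /Gfun fine_ge0// Lnorm01_ge0.
- move=> x w Lx Lw.
  have le_x := Lnorm01_le_weighted_pos q1 (ltW r0) Lx Lw.
  have /L01P[m1 _] := L01B q1 Lx Lw.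
  have /L01P[m2 _] := L01B q1 (L01N q1 Lx) Lw.
  rewrite /sym_functional !Vfun_Lnorm01//.
  move: le_x; set nx := fine _; set n1 := fine _; set n2 := fine _.
  set nw := fine _ => le_x.
  have nx0 : 0 <= nx by apply: fine_ge0; exact: Lnorm01_ge0.
  have n10 : 0 <= n1 by apply: fine_ge0; exact: Lnorm01_ge0.
  have n20 : 0 <= n2 by apply: fine_ge0; exact: Lnorm01_ge0.
  have nw0 : 0 <= nw by apply: fine_ge0; exact: Lnorm01_ge0.
  set E := expR (r / (p + 1)) in le_x.
  have E0 : 0 <= E by exact: expR_ge0.
  have Eq : E `^ (p + 1) = expR r.
    by rewrite -expRM divfK// gt_eqF.
  have le_xq : nx `^ (p + 1) <=
      3 `^ (p + 1) * (expR r * n1 `^ (p + 1) + expR r * n2 `^ (p + 1) + nw `^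
        (p + 1)).
    rewrite -Eq -!powRM//; apply: le_trans (powR_add3_le _ _ _ _);
      rewrite ?mulr_ge0//.
    rewrite -mulrDr; apply: ge0_ler_powR => //; first exact: ltW.
    by rewrite nnegrE !addr_ge0// mulr_ge0// addr_ge0.
  rewrite /Gfun n10 n20 ler_pdivrMl; last by rewrite !mulr_gt0// powR_gt0.
  apply: le_trans le_xq _; rewrite le_eqVlt; apply/orP; left; apply/eqP.
  field; rewrite !gt_eqF ?powR_gt0//.
- move=> T d T0 ad; split.
    rewrite Lnorm01_cst//= /M_const ger0_norm// mulr_ge0 ?sup_input_ge0//.
    by rewrite invr_ge0 subr_ge0 ltW.
  move=> rho0 rho [_ _ sol] Vhat t /andP[t0 tT].
  have [U [dU [VU dUE dUle]]] :=
    @lyapunov_dissipation R k lambda0 p r (M_const k d T) _ _ _ _ sol clam lam0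
      lamge p1 r0 kr.
  have dm : `|d t| <= (1 - `|k|) * M_const k d T.
    rewrite mulrA mulfV ?mul1r; last by rewrite gt_eqF// subr_gt0.
    by apply: sup_input_ub => //; rewrite t0.
  have dV : is_derive t 1 Vhat (dU t).
    apply: near_eq_is_derive (dUE _ (ltW t0)).
    by near=> s; rewrite -VU//; apply: ltW; near: s; exact: lt_nbhsr.
  split; first by case: dV.
  rewrite derive1E (@derive_val _ _ _ _ _ _ _ dV).
  by rewrite /Vhat (VU _ (ltW t0)); exact: dUle.
Unshelve. all: by end_near. Qed.

Lemma decay_rate_condition (R : realType) (k p r : R) : 0 < p + 1 -> k < 1 ->
  0 <= k -> (r%:E <= (p + 1)%:E * lne (k%:E^-1))%E ->
  k <= expR (- (r / (p + 1))).
Proof.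
move=> p1 k1; rewrite le_eqVlt => /predU1P[<- _|k0]; first exact: expR_ge0.
rewrite inver gt_eqF// lne_EFin ?invr_gt0// -EFinM lee_fin lnV ?posrE// => hr.
rewrite -[leLHS]lnK ?posrE// ler_expR lerNr ler_pdivrMr//; lra.
Qed.

Theorem proposition4p1 (R : realType) (k lambda0 : R) (lambda : R -> R)
    (hk : -1 < k < 1)
    (lambda_derivable : forall s : R, derivable lambda s 1)
    (lambda_C1 : continuous (derive1 lambda))
    (lambda_pos : forall s : R, 0 < lambda s)
    (lambda0_pos : 0 < lambda0)
    (lambda_ge : forall s : R, lambda0 <= lambda s) :
  (forall p r : R, 1 < p -> 0 < r ->
     (r%:E <= (p + 1)%:E * lne (`|k|%:E^-1))%E ->
     [/\ GISS_LF (transport_system k lambda) (p + 1)%:E (Vfun p r)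
           (fun d T => cst (M_const k d T)),
         ISS (transport_system k lambda) (p + 1)%:E,
         forall (d rho0 : R -> R) (rho : R -> R -> R),
           transport_system k lambda d rho0 rho ->
           forall t : R, 0 < t ->
           (Lnorm01 (p + 1)%:E (rho ^~ t) <=
            (2 * expR (r / (p + 1)))%:E * Lnorm01 (p + 1)%:E rho0
              * (expR (- (r * lambda0 / (p + 1) * t)))%:E
            + (2 / (1 - `|k|) * sup_input d t)%:E)%E &
         `|k| <= 1 / 2 ->
         forall (d rho0 : R -> R) (rho : R -> R -> R),
           transport_system k lambda d rho0 rho ->
           forall t : R, 0 < t ->
           (Lnorm01 (p + 1)%:E (rho ^~ t) <=
            (2 * expR (r / (p + 1)))%:E * Lnorm01 (p + 1)%:E rho0
              * (expR (- (r * lambda0 / (p + 1) * t)))%:E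
            + (2 * sup_input d t)%:E)%E])
  /\
  (forall q : \bar R, (2%:E <= q)%E ->
     [/\ ISS (transport_system k lambda) q,
         k != 0 ->
         forall (d rho0 : R -> R) (rho : R -> R -> R),
           transport_system k lambda d rho0 rho ->
           forall t : R, 0 < t ->
           (Lnorm01 q (rho ^~ t) <=
            (2 / `|k|)%:E * Lnorm01 q rho0 * (`|k| `^ (lambda0 * t / 2))%:E
            + (2 / (1 - `|k|) * sup_input d t)%:E)%E &
         k = 0 ->
         forall (d rho0 : R -> R) (rho : R -> R -> R),
           transport_system k lambda d rho0 rho ->
           forall t : R, 2 < lambda0 * t ->
           (Lnorm01 q (rho ^~ t) <= (2 * sup_input d t)%:E)%E]).
Proof.
have k1 : `|k| < 1 by rewrite ltr_norml.
have clam : continuous lambda.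
  by move=> s; apply: differentiable_continuous; apply/derivable1_diffP.
split=> [p r p1 r0 hr|q q2].
  have q0 : 0 < p + 1 by lra.
  have q1 : (1 <= (p + 1)%:E)%E by rewrite lee_fin; lra.
  have kc := decay_rate_condition q0 k1 (normr_ge0 k) hr.
  have c0 : 0 < r / (p + 1) by rewrite divr_gt0.
  have estimate d rho0 rho (C : R) t : transport_system k lambda d rho0 rho ->
      0 < t -> (1 - `|k|)^-1 <= C ->
      (Lnorm01 (p + 1)%:E (rho ^~ t) <=
        (2 * expR (r / (p + 1)))%:E * Lnorm01 (p + 1)%:E rho0
          * (expR (- (r * lambda0 / (p + 1) * t)))%:E
        + (C * sup_input d t)%:E)%E.
    move=> sys t0 kC; have [ad _ sol] := sys.
    rewrite (initial_Lnorm01 sol q1) -!EFinM -EFinD.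
    apply: le_trans (transport_estimate sys k1 clam lambda0_pos lambda_ge q1 c0
      kc t0) _.
    rewrite lee_fin (_ : r * lambda0 / (p + 1) * t = r / (p + 1) * lambda0 *
      t); last by ring.
    by rewrite lerD2l ler_wpM2r ?sup_input_ge0.
  split.
  - apply: (@transport_GISS _ _ lambda0) => //; first lra.
    have -> : - r = - (r / (p + 1)) * (p + 1) by rewrite mulNr divfK// gt_eqF.
    by rewrite expRM; apply: ge0_ler_powR; rewrite ?nnegrE ?expR_ge0 ?(ltW q0).
  - exact: transport_ISS k1 clam lambda0_pos lambda_ge q1 c0 kc.
  - move=> d rho0 rho sys t t0; apply: estimate => //.
    by rewrite ler_peMl ?invr_ge0 ?subr_ge0 ?(ltW k1)// ler1n.
  - move=> k2 d rho0 rho sys t t0; apply: estimate => //.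
    rewrite -div1r ler_pdivrMr ?subr_gt0//; lra.
have q1 : (1 <= q)%E by apply: le_trans q2; rewrite lee_fin ler1n.
split.
- have [k0|k0] := eqVneq k 0.
    apply: (@transport_ISS _ _ lambda0 1) => //.
    by rewrite k0 normr0 expR_ge0.
  have nk : 0 < `|k| by rewrite normr_gt0.
  apply: (@transport_ISS _ _ lambda0 (- ln `|k|)) => //.
    by rewrite oppr_gt0 ln_lt0// nk.
  by rewrite opprK lnK ?posrE.
- move=> k0 d rho0 rho sys t t0; have [ad _ sol] := sys.
  have nk : 0 < `|k| by rewrite normr_gt0.
  have c0 : 0 < - ln `|k| by rewrite oppr_gt0 ln_lt0// nk.
  have kc : `|k| <= expR (- - ln `|k|) by rewrite opprK lnK ?posrE.
  rewrite (initial_Lnorm01 sol q1) -!EFinM -EFinD.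
  apply: le_trans (transport_estimate sys k1 clam lambda0_pos lambda_ge q1 c0
    kc t0) _.
  have n0 : 0 <= fine (Lnorm01 q rho0) by apply: fine_ge0; exact: Lnorm01_ge0.
  rewrite lee_fin expRN lnK ?posrE//; apply: lerD.
    apply: ler_wpM2l; first by rewrite !mulr_ge0// invr_ge0 ltW.
    rewrite /powR gt_eqF// ler_expR.
    have : 0 <= lambda0 * t * - ln `|k| by rewrite !mulr_ge0// ltW.
    lra.
  rewrite ler_wpM2r ?sup_input_ge0//.
  by rewrite ler_peMl ?invr_ge0 ?subr_ge0 ?(ltW k1)// ler1n.
- move=> k0 d rho0 rho sys t t2; rewrite k0 in sys; have [ad _ _] := sys.
  have lt1 : 1 < lambda0 * t by lra.
  have t0 : 0 < t by rewrite -(pmulr_rgt0 _ lambda0_pos); lra.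
  apply: le_trans (transport_open_loop_bound sys clam lambda0_pos lambda_ge q1
    lt1) _.
  by rewrite lee_fin ler_peMl ?sup_input_ge0// ler1n.
Qed.
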